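(* Let $(n_i)_{i\ge 1}$ be a strictly increasing sequence of natural numbers with $n_i\mid n_{i+1}$ for every $i$. Let $\Gamma:=\mathbb{Z}\rtimes\mathbb{Z}_2$ be the infinite dihedral group, let $\Gamma_i:=n_i\mathbb{Z}\rtimes\mathbb{Z}_2$ for $i\geq 1$, and let $\Gamma\curvearrowright X=\varprojlim\Gamma/\Gamma_i$ be the associated odometer. Then, for every $k\geq 1$ (and up to isomorphism of groups), $$H_0(\Gamma,C(X,\mathbb{Z}))=\left\{\frac{m}{n_i}:m\in\mathbb{Z},\,i\geq 1\right\}\subset\mathbb{Q},$$ $$H_{2k}(\Gamma,C(X,\mathbb{Z}))=0,$$ $$H_{2k-1}(\Gamma,C(X,\mathbb{Z}))=\begin{cases}\mathbb{Z}_2 & \text{if } \frac{n_{i+1}}{n_i}\text{ is even for infinitely many } i,\\ (\mathbb{Z}_2)^2 & \text{otherwise.}\end{cases}$$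
   Context: $\mathbb{Z}_2=\{0,1\}$ acts on $\mathbb{Z}$ by multiplication by $-1$, so the product in $\mathbb{Z}\rtimes\mathbb{Z}_2$ is $(m,a)(n,b)=(m+(-1)^a n,a+b)$; $n\mathbb{Z}\rtimes\mathbb{Z}_2$ is the subgroup $\{(m,a):n\mid m\}$. Odometer: given a group $\Gamma$ and a sequence $(\Gamma_i)_{i\geq 1}$ of finite index subgroups with $\Gamma_{i+1}\subsetneq\Gamma_i$ for all $i$, let $p_i\colon\Gamma/\Gamma_{i+1}\to\Gamma/\Gamma_i$, $p_i(\gamma\Gamma_{i+1})=\gamma\Gamma_i$, and let $X=\varprojlim(\Gamma/\Gamma_i,p_i)\subset\prod_i\Gamma/\Gamma_i$ with the topology inherited from the product of finite discrete spaces. The group $\Gamma$ acts on $X$ by $\gamma(x_i)=(\gamma x_i)$; this action is called an odometer. $C(X,\mathbb{Z})$ is the group of continuous functions $X\to\mathbb{Z}$ ($\mathbb{Z}$ discrete), a $\Gamma$-module via $(\gamma f)(x)=f(\gamma^{-1}x)$; $H_*(\Gamma,\cdot)$ is group homology with coefficients. *)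

(* Defs.v *)
From HB Require Import structures.
From mathcomp Require Import all_boot all_order all_algebra.
From mathcomp Require Import finmap generic_quotient.
From mathcomp Require Import all_classical topology.
From mathcomp Require Import function_spaces subtype_topology.
From mathcomp.multinomials Require Import monalg.
From mathcomp Require Import zify.

Set Implicit Arguments.
Unset Strict Implicit.
Unset Printing Implicit Defensive.

Import GRing.Theory.

Local Open Scope classical_set_scope.
Local Open Scope ring_scope.
Local Open Scope quotient_scope.

HB.mixin Record isGModule (G : groupType) M of GRing.Zmodule M := {
  gact : G -> M -> M;
  gact1 : forall m, gact 1%g m = m;
  gactM : forall x y m, gact (x * y)%g m = gact x (gact y m);
  gactD : forall x, {morph gact x : m p / m + p}
}.

#[short(type="gmodType")]
HB.structure Definition GModule (G : groupType) :=
  {M of isGModule G M & GRing.Zmodule M}.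

Lemma sum_cancel (V : zmodType) N (F : 'I_N.+2 -> 'I_N.+1 -> V) :
  (forall (i : 'I_N.+2) (j : 'I_N.+1), (i <= j)%N ->
     F (lift ord0 j) (inord i) = - F i j) ->
  \sum_i \sum_j F i j = 0.
Proof.
move=> HF; rewrite pair_bigA /= (bigID (fun p : 'I_N.+2 * 'I_N.+1 => (p.1 <= p.2)%N)) /=.
rewrite addrC.
pose h (p : 'I_N.+2 * 'I_N.+1) : 'I_N.+2 * 'I_N.+1 := (lift ord0 p.2, inord p.1).
pose h' (p : 'I_N.+2 * 'I_N.+1) : 'I_N.+2 * 'I_N.+1 :=
   (widen_ord (leqnSn _) p.2, inord p.1.-1).
rewrite (reindex_onto h h') /=; last first.
  move=> [i j] /=; rewrite -ltnNge => ji; rewrite /h /h' /=; congr pair.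
    apply/val_inj; rewrite /= /bump /= inordK; have := ltn_ord i; lia.
  by apply/val_inj; rewrite /= inordK.
rewrite [X in X + _](eq_bigl (fun p : 'I_N.+2 * 'I_N.+1 => (p.1 <= p.2)%N)).
  rewrite [X in X + _](eq_bigr (fun p => - F p.1 p.2)); last by move=> [i j] /= /HF.
  by rewrite sumrN addNr.
move=> [i j] /=; rewrite /h /h' /= /bump /=.
have li := ltn_ord i; have lj := ltn_ord j.
apply/andP/idP => [[]|ij].
  rewrite -ltnNge => lt /eqP[] hi _; move: lt.
  have := ltn_ord (inord i : 'I_N.+1); have {}hi := congr1 val hi; rewrite /= in hi; rewrite hi => iN.
  lia.
rewrite inordK; last lia.
split; first by lia.
apply/eqP; congr pair; apply/val_inj; rewrite /= ?inordK //; lia.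
Qed.

Section GroupHomology.
Variables (G : groupType) (M : gmodType G).

Lemma gactB (x : G) : {morph @gact G M x : m p / m - p}.
Proof.
move=> m p; apply: (addIr (gact x p)).
by rewrite subrK -gactD subrK.
Qed.

(* C_n(G, M) = Z[G^n] (x) M, the inhomogeneous bar complex with coefficients:
   << m *g t >> is the elementary chain m (x) [t_0 | ... | t_(n-1)]. *)
Definition chain (n : nat) : zmodType := {malg M[{ffun 'I_n -> G}]}.

(* face 0 drops the first entry, face n.+1 drops the last one, and for
   0 < i < n.+1, face i replaces the adjacent entries t_(i-1), t_i by their
   product. *)
Definition face n (i : 'I_n.+2) (t : {ffun 'I_n.+1 -> G}) : {ffun 'I_n -> G} :=
  [ffun j : 'I_n =>
    if (j.+1 < i)%N then t (widen_ord (leqnSn n) j)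
    else if j.+1 == i :> nat then
      (t (widen_ord (leqnSn n) j) * t (lift ord0 j))%g
    else t (lift ord0 j)].

(* M is a left module, regarded as a right module through m g = g^-1 m. *)
Definition face_coef n (i : 'I_n.+2) (t : {ffun 'I_n.+1 -> G}) (m : M) : M :=
  if i == ord0 then gact (t ord0)^-1%g m else m.

Lemma face_coefB n (i : 'I_n.+2) (t : {ffun 'I_n.+1 -> G}) :
  {morph face_coef i t : m p / m - p}.
Proof. by rewrite /face_coef => m p; case: ifP => // _; rewrite gactB. Qed.

Lemma face_coef0 n (i : 'I_n.+2) (t : {ffun 'I_n.+1 -> G}) :
  face_coef i t 0 = 0.
Proof. by rewrite -[X in face_coef _ _ X](subrr 0) face_coefB subrr. Qed.

Definition boundary n (c : chain n.+1) : chain n :=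
  \sum_(t <- msupp c) \sum_(i < n.+2)
    << face_coef i t c@_t *g face i t >> *~ (-1) ^+ i.

Lemma boundaryEw n (c : chain n.+1) (D : {fset {ffun 'I_n.+1 -> G}}) :
  (msupp c `<=` D)%fset ->
  boundary c = \sum_(t <- D) \sum_(i < n.+2)
    << face_coef i t c@_t *g face i t >> *~ (-1) ^+ i.
Proof.
move=> cD; rewrite /boundary; apply: big_fset_incl cD _ => t _ /mcoeff_outdom ct0.
rewrite ct0; apply: big1 => i _.
by rewrite face_coef0 monalgU0 mul0rz.
Qed.

Lemma boundaryB n : {morph @boundary n : c d / c - d}.
Proof.
move=> c d.
pose D := (msupp c `|` msupp d)%fset.
have cD : (msupp c `<=` D)%fset := fsubsetUl _ _.
have dD : (msupp d `<=` D)%fset := fsubsetUr _ _.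
rewrite (boundaryEw cD) (boundaryEw dD) (boundaryEw (msuppB_le c d)) -sumrB.
apply: eq_bigr => t _; rewrite -sumrB; apply: eq_bigr => i _.
by rewrite mcoeffB face_coefB monalgUB mulrzBl.
Qed.

HB.instance Definition _ n :=
  GRing.isZmodMorphism.Build (chain n.+1) (chain n) (@boundary n) (@boundaryB n).

Lemma boundaryU n (t : {ffun 'I_n.+1 -> G}) (m : M) :
  boundary (<< m *g t >> : chain n.+1) = \sum_(i < n.+2)
    << face_coef i t m *g face i t >> *~ (-1) ^+ i.
Proof.
have h := @boundaryEw n << m *g t >> [fset t]%fset msuppU_le.
rewrite h big_seq_fset1; apply: eq_bigr => i _.
by rewrite mcoeffUU.
Qed.

Lemma boundaryMz n (c : chain n.+1) (z : int) :
  boundary (c *~ z) = boundary c *~ z.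
Proof. exact: raddfMz. Qed.

Lemma face_face n (t : {ffun 'I_n.+2 -> G}) (i : 'I_n.+3) (j : 'I_n.+2) :
  (i <= j)%N ->
  face (inord i) (face (lift ord0 j) t) = face j (face i t).
Proof.
move=> ij; apply/ffunP => k.
have lk := ltn_ord k; have li := ltn_ord i; have lj := ltn_ord j.
have iK : (inord i : 'I_n.+2) = i :> nat by rewrite inordK //; lia.
have e0 (h : (k < n.+2)%N) : widen_ord (leqnSn n.+1) (widen_ord (leqnSn n) k) = Ordinal h.
  by apply/val_inj.
have e1 (h : (k.+1 < n.+2)%N) : widen_ord (leqnSn n.+1) (lift ord0 k) = Ordinal h.
  by apply/val_inj => /=; rewrite /bump /=; lia.
have e1' (h : (k.+1 < n.+2)%N) : lift ord0 (widen_ord (leqnSn n) k) = Ordinal h.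
  by apply/val_inj => /=; rewrite /bump /=; lia.
have e2 (h : (k.+2 < n.+2)%N) : lift ord0 (lift ord0 k) = Ordinal h.
  by apply/val_inj => /=; rewrite /bump /=; lia.
have h0 : (k < n.+2)%N by lia.
have h1 : (k.+1 < n.+2)%N by lia.
have h2 : (k.+2 < n.+2)%N by lia.
rewrite !ffunE iK.
rewrite (e0 h0) (e1 h1) (e1' h1) (e2 h2) /= /bump /= !add1n.
rewrite !ltnS !eqSS.
case: (ltngtP k.+1 i) => h3; case: (ltngtP k j) => h4;
  case: (ltngtP k.+1 j) => h5; case: (ltngtP k.+2 i) => h6 //=; try lia.
all: try by rewrite ?mulgA.
Qed.

Lemma boundary_sum n I (r : seq I) (F : I -> chain n.+1) :
  boundary (\sum_(i <- r) F i) = \sum_(i <- r) boundary (F i).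
Proof. exact: raddf_sum. Qed.

Lemma boundary_boundary n (c : chain n.+2) : boundary (boundary c) = 0.
Proof.
have cE : c = \sum_(t <- msupp c) << c@_t *g t >> := monalgE c.
have -> : boundary c = \sum_(t <- msupp c) boundary (<< c@_t *g t >> : chain n.+2).
  by rewrite {1}cE boundary_sum.
rewrite boundary_sum big1 // => t _.
set m := (c@_t : M); rewrite boundaryU boundary_sum.
rewrite (eq_bigr (fun i : 'I_n.+3 => \sum_(j < n.+2)
    << face_coef j (face i t) (face_coef i t m) *g face j (face i t) >>
      *~ ((-1) ^+ i * (-1) ^+ j))); last first.
  move=> i _; rewrite boundaryMz boundaryU mulrz_suml.
  by apply: eq_bigr => j _; rewrite -mulrzA mulrC.
apply: sum_cancel => i j ij.
have li := ltn_ord i; have lj := ltn_ord j.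
have iK : (inord i : 'I_n.+2) = i :> nat by rewrite inordK //; lia.
rewrite face_face // iK -mulrNz.
have -> : face_coef (inord i) (face (lift ord0 j) t) (face_coef (lift ord0 j) t m)
   = face_coef j (face i t) (face_coef i t m).
  rewrite /face_coef -!val_eqE /= iK /bump /=.
  case: eqVneq => i0 /=; last first.
    by case: eqVneq => j0 //; lia.
  have -> : face (lift ord0 j) t ord0 = if j == ord0 then (t ord0 * t (lift ord0 ord0))%g else t ord0.
    rewrite ffunE /= /bump /= -val_eqE /= !add1n !ltnS eqSS.
    have -> : widen_ord (leqnSn n.+1) ord0 = ord0 by apply/val_inj.
    by case: (nat_of_ord j).
  rewrite -val_eqE /=; case: eqVneq => j0 //.
  rewrite ffunE /= i0 /= -gactM invgM; congr gact.
congr (_ *~ _).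
by rewrite /= /bump /= add1n exprS mulN1r mulNr mulrC.
Qed.

Definition is_cycle n : {pred chain n} :=
  match n with
  | 0 => fun=> true
  | k.+1 => fun c : chain k.+1 => boundary c == 0
  end.

Lemma is_cycle_zmod_closed n : zmod_closed (@is_cycle n).
Proof.
case: n => [|n]; first by split.
split=> [|c d]; rewrite !unfold_in; first by rewrite raddf0.
by move=> /eqP c0 /eqP d0; rewrite raddfB /= c0 d0 subrr.
Qed.

HB.instance Definition _ n :=
  GRing.isZmodClosed.Build (chain n) (@is_cycle n) (@is_cycle_zmod_closed n).

Record cycle n := Cycle { cycle_val : chain n; _ : cycle_val \in @is_cycle n }.
HB.instance Definition _ n := [isSub for @cycle_val n].
HB.instance Definition _ n := [Choice of cycle n by <:].
HB.instance Definition _ n := [SubChoice_isSubZmodule of cycle n by <:].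

Definition is_boundary n : {pred cycle n} :=
  fun z => `[< exists c : chain n.+1, boundary c = val z >].

Lemma is_boundary_zmod_closed n : zmod_closed (@is_boundary n).
Proof.
split=> [|z w]; rewrite !unfold_in.
  by apply/asboolP; exists 0; rewrite raddf0.
move=> /asboolP[c cz] /asboolP[d dw]; apply/asboolP; exists (c - d).
by rewrite !raddfB /= cz dw.
Qed.

HB.instance Definition _ n :=
  GRing.isZmodClosed.Build (cycle n) (@is_boundary n)
    (@is_boundary_zmod_closed n).

Definition homology n : zmodType := Quotient.quot (@is_boundary n).

End GroupHomology.

Section CosetSpace.
Variables (G : groupType) (H : groupClosed G).

Definition left_cong (x y : G) : bool := (x^-1 * y)%g \in H.

Lemma left_cong_equiv : equiv_class_of left_cong.
Proof.
rewrite /left_cong; split=> [x|x y|y x z].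
- by rewrite mulVg gpred1.
- by rewrite -gpredV invgM invgK.
- by move=> xy yz; rewrite -[x^-1%g](mulgK y) -mulgA gpredM.
Qed.

Canonical left_cong_equivRel := EquivRelPack left_cong_equiv.
Canonical left_cong_encModRel := defaultEncModRel left_cong.

Definition coset_space := {eq_quot left_cong}.
HB.instance Definition _ := Choice.on coset_space.
HB.instance Definition _ := EqQuotient.on coset_space.

Lemma coset_eqP (x y : G) :
  reflect (\pi_coset_space x = \pi_coset_space y) ((x^-1 * y)%g \in H).
Proof. exact/eqmodP. Qed.

Definition coset_act (g : G) (x : coset_space) : coset_space :=
  \pi_coset_space (g * repr x)%g.

Lemma coset_actE (g x : G) :
  coset_act g (\pi_coset_space x) = \pi_coset_space (g * x)%g.
Proof.
apply/coset_eqP; rewrite invgM -mulgA mulKg.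
by apply/coset_eqP; rewrite reprK.
Qed.

Lemma coset_act1 (x : coset_space) : coset_act 1%g x = x.
Proof. by rewrite -[x]reprK coset_actE mul1g. Qed.

Lemma coset_actM (g h : G) (x : coset_space) :
  coset_act (g * h)%g x = coset_act g (coset_act h x).
Proof. by rewrite -[x]reprK (coset_actE h) !coset_actE mulgA. Qed.

End CosetSpace.

Arguments coset_space {G} H.

(* The projection gK |-> gH; it is meaningful when K is contained in H. *)
Definition coset_proj (G : groupType) (K H : groupClosed G)
  (x : coset_space K) : coset_space H := \pi_(coset_space H) (repr x).

Lemma coset_projE (G : groupType) (K H : groupClosed G) (g : G) :
  {subset K <= H} ->
  coset_proj H (\pi_(coset_space K) g) = \pi_(coset_space H) g.
Proof.
by move=> sKH; apply/coset_eqP/sKH/coset_eqP; rewrite reprK.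
Qed.

(* Chains Gamma_1 > Gamma_2 > ... are indexed from 0. *)
Record subgroup_chain (G : groupType) := SubgroupChain {
  chain_group :> nat -> groupClosed G;
  chain_finite : forall i, finite_set [set: coset_space (chain_group i)];
  chain_sub : forall i, {subset chain_group i.+1 <= chain_group i};
  chain_proper :
    forall i, exists2 x, x \in chain_group i & x \notin chain_group i.+1
}.

Lemma continuous_from_discrete (D : discreteTopologicalType)
  (Y : topologicalType) (f : D -> Y) : continuous f.
Proof.
move=> x U /nbhs_singleton Ufx; apply: (filterS _ (discrete_set1 x)).
by move=> _ ->.
Qed.

Lemma continuous_to_prod (X : topologicalType) (I : Type)
    (T : I -> topologicalType) (f : X -> prod_topology T) :
  (forall i, continuous (fun x => f x i)) -> continuous f.
Proof.
move=> cf x; apply/cvg_sup => i.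
exact: (@continuous_comp_initial _ _ _ (fun y : prod_topology T => y i) f (cf i)).
Qed.

Section Odometer.
Variables (G : groupType) (S : subgroup_chain G).

Definition odometer_set :
    set (prod_topology (fun i => discrete_topology (coset_space (S i)))) :=
  [set x | forall i, coset_proj (S i) (x i.+1) = x i].

Definition odometer : topologicalType := set_type odometer_set.

Lemma odometer_act_subproof (g : G) (x : odometer) :
  (fun i => coset_act g (set_val x i)) \in odometer_set.
Proof.
apply/mem_set => i /=; have xi : coset_proj (S i) (set_val x i.+1) = set_val x i.
  by have /set_mem/(_ i) := valP x.
rewrite -{}xi -[set_val x i.+1]reprK coset_actE.
by rewrite !coset_projE ?coset_actE //; exact: chain_sub.
Qed.

Definition odometer_act (g : G) (x : odometer) : odometer :=
  exist (fun y => y \in odometer_set) _ (odometer_act_subproof g x).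

Lemma odometer_act1 (x : odometer) : odometer_act 1%g x = x.
Proof. by apply/val_inj/functional_extensionality_dep => i; exact: coset_act1. Qed.

Lemma odometer_actM (g h : G) (x : odometer) :
  odometer_act (g * h)%g x = odometer_act g (odometer_act h x).
Proof. by apply/val_inj/functional_extensionality_dep => i; exact: coset_actM. Qed.

Lemma odometer_act_continuous (g : G) : continuous (odometer_act g).
Proof.
apply: continuous_comp_initial; apply: continuous_to_prod => i x.
apply: (@continuous_comp _ _ _ (fun y : odometer => set_val y i)
  (coset_act g : discrete_topology (coset_space (S i)) ->
                 discrete_topology (coset_space (S i)))).
  apply: (@continuous_comp _ _ _ (set_val : odometer -> _) (@proj _ _ i)).
    exact: initial_continuous.
  exact: proj_continuous.
exact: continuous_from_discrete.
Qed.

End Odometer.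

Section ContinuousIntegerFunctions.
Variable X : topologicalType.

Definition cint : Type := continuousType X (discrete_topology int).
HB.instance Definition _ := Choice.on cint.

Implicit Types f g h : cint.

Lemma cint_lift2_continuous (F : int -> int -> int) f g :
  continuous (fun x => F (f x) (g x) : discrete_topology int).
Proof.
have cts1 (h : cint) x : nbhs x (h @^-1` [set h x]).
  have hx := @cts_fun _ _ h x; apply: hx.
  exact: (@discrete_set1 (discrete_topology int)).
move=> x; apply/discrete_cvg; apply: filterS (filterI (cts1 f x) (cts1 g x)).
by move=> y [/= -> ->].
Qed.

Definition cint_add f g : cint := mkcts (@cint_lift2_continuous +%R f g).
Definition cint_opp f : cint :=
  mkcts (@cint_lift2_continuous (fun m _ => - m) f f).
Definition cint_zero : cint :=
  mkcts (@cst_continuous X (discrete_topology int) 0).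

Lemma cint_addA : associative cint_add.
Proof. by move=> f g h; apply/continuousEP => x; exact: addrA. Qed.

Lemma cint_addC : commutative cint_add.
Proof. by move=> f g; apply/continuousEP => x; exact: addrC. Qed.

Lemma cint_add0 : left_id cint_zero cint_add.
Proof. by move=> f; apply/continuousEP => x; exact: add0r. Qed.

Lemma cint_addN : left_inverse cint_zero cint_opp cint_add.
Proof. by move=> f; apply/continuousEP => x; exact: addNr. Qed.

HB.instance Definition _ :=
  GRing.isZmodule.Build cint cint_addA cint_addC cint_add0 cint_addN.

End ContinuousIntegerFunctions.

Section OdometerModule.
Variables (G : groupType) (S : subgroup_chain G).

Definition odometer_cint : Type := cint (odometer S).
HB.instance Definition _ := GRing.Zmodule.on odometer_cint.

Implicit Types f : odometer_cint.

Lemma odometer_cint_act_subproof (g : G) f :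
  continuous (fun x => f (odometer_act g^-1%g x)).
Proof.
move=> x; apply: (@continuous_comp _ _ _ (odometer_act g^-1%g) f).
  exact: odometer_act_continuous.
exact: cts_fun.
Qed.

Definition odometer_cint_act (g : G) f : odometer_cint :=
  mkcts (@odometer_cint_act_subproof g f).

Lemma odometer_cint_act1 f : odometer_cint_act 1%g f = f.
Proof.
by apply/continuousEP => x; rewrite /= /mkcts invg1 odometer_act1.
Qed.

Lemma odometer_cint_actM (g h : G) f :
  odometer_cint_act (g * h)%g f = odometer_cint_act g (odometer_cint_act h f).
Proof.
by apply/continuousEP => x; rewrite /= /mkcts invgM odometer_actM.
Qed.

Lemma odometer_cint_actD (g : G) :
  {morph odometer_cint_act g : f1 f2 / f1 + f2}.
Proof. by move=> f1 f2; apply/continuousEP. Qed.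

HB.instance Definition _ := isGModule.Build G odometer_cint
  odometer_cint_act1 odometer_cint_actM odometer_cint_actD.

End OdometerModule.

(* The semidirect product of Z by Z_2 acting by negation. *)
Definition Dinf : Type := (int * 'Z_2)%type.
HB.instance Definition _ := Choice.on Dinf.

Section InfiniteDihedralGroup.

Definition dinf_mul (x y : Dinf) : Dinf :=
  (x.1 + (-1) ^+ (x.2 : nat) * y.1, x.2 + y.2).
Definition dinf_one : Dinf := (0, 0).
Definition dinf_inv (x : Dinf) : Dinf := (- (-1) ^+ (x.2 : nat) * x.1, - x.2).

Lemma sign_Z2D (a b : 'Z_2) :
  (-1) ^+ ((a + b)%R : nat) = (-1) ^+ (a : nat) * (-1) ^+ (b : nat) :> int.
Proof. by case: a b => [[|[|?]] ?] [[|[|?]] ?]. Qed.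

Lemma sign_Z2N (a : 'Z_2) :
  (-1) ^+ ((- a)%R : nat) = (-1) ^+ (a : nat) :> int.
Proof. by case: a => [[|[|?]] ?]. Qed.

Lemma sign_Z2K (a : 'Z_2) : (-1) ^+ (a : nat) * (-1) ^+ (a : nat) = 1 :> int.
Proof. by case: a => [[|[|?]] ?]. Qed.

Lemma dinf_mulA : associative dinf_mul.
Proof.
by move=> x y z; rewrite /dinf_mul /= sign_Z2D mulrDr !addrA !mulrA.
Qed.

Lemma dinf_mul1 : left_id dinf_one dinf_mul.
Proof. by case=> m a; rewrite /dinf_mul /= expr0 mul1r !add0r. Qed.

Lemma dinf_mulr1 : right_id dinf_one dinf_mul.
Proof. by case=> m a; rewrite /dinf_mul /= mulr0 !addr0. Qed.

Lemma dinf_mulV : left_inverse dinf_one dinf_inv dinf_mul.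
Proof.
case=> m a; rewrite /dinf_mul /dinf_inv /= sign_Z2N mulNr addNr.
by congr pair; exact: addNr.
Qed.

Lemma dinf_mulrV : right_inverse dinf_one dinf_inv dinf_mul.
Proof.
case=> m a; rewrite /dinf_mul /dinf_inv /= mulNr mulrN mulrA sign_Z2K mul1r.
by rewrite subrr; congr pair; exact: subrr.
Qed.

HB.instance Definition _ := isGroup.Build Dinf
  dinf_mulA dinf_mul1 dinf_mulr1 dinf_mulV dinf_mulrV.

Definition dinf_sub (d : nat) : {pred Dinf} := fun x => (d %| x.1)%Z.

Lemma dinf_subE d (x : Dinf) : (x \in dinf_sub d) = (d %| x.1)%Z.
Proof. by []. Qed.

Lemma dinf_subM d : mulg_closed (dinf_sub d).
Proof.
move=> x y; rewrite !dinf_subE => dx dy.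
by rewrite rpredD // dvdz_mull.
Qed.

Lemma dinf_sub1 d : 1%g \in dinf_sub d.
Proof. by rewrite dinf_subE dvdz0. Qed.

Lemma dinf_subV d : invg_closed (dinf_sub d).
Proof. by move=> x; rewrite !dinf_subE => dx; rewrite dvdz_mull. Qed.

HB.instance Definition _ d := isMulClosed.Build Dinf (dinf_sub d) (@dinf_subM d).
HB.instance Definition _ d := isMul1Closed.Build Dinf (dinf_sub d) (dinf_sub1 d).
HB.instance Definition _ d := isInvClosed.Build Dinf (dinf_sub d) (@dinf_subV d).

End InfiniteDihedralGroup.

Section DihedralChain.
Variable n : nat -> nat.
Hypotheses (n_incr : {homo n : i j / (i < j)%N})
  (n_dvd : forall i, (n i %| n i.+1)%N).

Lemma dihedral_index_gt0 i : (0 < n i)%N.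
Proof.
have := n_dvd i; have := n_incr (ltnSn i).
by case: (n i) => // ni1; rewrite dvd0n => /eqP ni0; rewrite ni0 in ni1.
Qed.

Definition dihedral_sub (i : nat) : groupClosed Dinf := dinf_sub (n i).

Lemma dihedral_finite i : finite_set [set: coset_space (dihedral_sub i)].
Proof.
pose f (m : 'I_(n i)) : coset_space (dihedral_sub i) :=
  \pi_(coset_space (dihedral_sub i)) ((m : nat)%:Z, 0).
apply: (@sub_finite_set _ _ (f @` setT)); last exact/finite_image/finite_finset.
move=> x _; rewrite -[x]reprK; case: (repr x) => m a.
have ni0 : (n i)%:Z != 0 by rewrite eqz_nat -lt0n dihedral_index_gt0.
have mlt : (`|(m %% n i)%Z| < n i)%N.
  by rewrite -ltz_nat gez0_abs ?modz_ge0 // ltz_pmod // ltz_nat dihedral_index_gt0.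
exists (Ordinal mlt) => //; apply/coset_eqP.
rewrite dinf_subE /= gez0_abs ?modz_ge0 //.
rewrite expr0 mulN1r.
by rewrite mul1r {2}(divz_eq m (n i)) addrC addrK dvdz_mull.
Qed.

Lemma dihedral_subset i : {subset dihedral_sub i.+1 <= dihedral_sub i}.
Proof.
move=> x; rewrite !dinf_subE; apply: dvdz_trans.
by rewrite dvdzE /= n_dvd.
Qed.

Lemma dihedral_proper i :
  exists2 x, x \in dihedral_sub i & x \notin dihedral_sub i.+1.
Proof.
exists ((n i)%:Z, 0); rewrite dinf_subE /= dvdzE //=.
by rewrite gtnNdvd ?dihedral_index_gt0 // n_incr.
Qed.

Definition dihedral_chain : subgroup_chain Dinf :=
  SubgroupChain dihedral_finite dihedral_subset dihedral_proper.

End DihedralChain.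

Definition zmod_iso (A B : zmodType) : Prop :=
  exists f : {additive A -> B}, bijective f.

(* Main.v *)
From HB Require Import structures.
From mathcomp Require Import all_boot all_order all_algebra.
From mathcomp Require Import finmap.
From mathcomp Require Import all_classical topology.
From mathcomp.multinomials Require Import monalg.
From mathcomp Require Import zify ring.
Require Import Defs.

Set Implicit Arguments.
Unset Strict Implicit.
Unset Printing Implicit Defensive.

Import Order.TTheory GRing.Theory Num.Theory.

Local Open Scope classical_set_scope.
Local Open Scope ring_scope.

(** Write [s] and [t] for the reflections [m |-> - m] and [m |-> 1 - m]; they
    generate the infinite dihedral group [Dinf], which is the free product of
    the two subgroups of order two generated by [s] and by [t]. For a free
    product of that shape there is a very small free resolution of the
    integers: one generator in degree zero and two generators, one for each
    reflection [r], in every positive degree, the differential being [r - 1] or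
    [r + 1] alternately. Any two free resolutions are chain homotopy
    equivalent, so the homology of [Dinf] with coefficients in a module [M],
    defined by the bar complex, can be computed from the small one
    ([comparison_inverse], [bar_acyclic], [small_acyclic]).

    Let [M] be a module such that, for each of the two reflections [r], every
    [u] with [r u = - u] has the form [r v - v], and such that no nonzero
    element is changed into its opposite by both reflections. The small complex
    then shows that the homology vanishes in positive even degrees
    ([homology_even]), and that in odd degrees it is the direct sum over the
    two reflections of the invariants of [r] modulo the elements [r v + v]
    ([homology_odd]).

    For the odometer, a continuous integer function on the compact space [X]
    factors through some finite level ([cint_level]). Restricting it to the
    dense orbit of integers identifies the module with that of all functions on
    the integers that are periodic with some period [n i], the reflections
    acting by [m |-> - m] and [m |-> 1 - m]. Splitting each two-point orbit of
    residues into a smaller and a larger element, one sees that both conditions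
    on the module hold, and that an [r]-invariant function [f] has the form [r
    v + v] exactly when its values at the residues fixed by [r] are even
    ([odd_split_periodic], [even_split_periodic]). So the odd homology counts
    parities at the fixed points of [s] and [t] in [X], that is at the
    solutions of [2 x = 0] and of [2 x = 1]. If infinitely many quotients of
    consecutive periods are even, only [0] is such a solution
    ([homology_odd_one_center]). Otherwise there are exactly two
    ([homology_odd_two_centers]): [0] and one half when all periods are odd
    ([homology_odd_period]), and [0] and half of the period when the periods
    are eventually even ([homology_even_period]).

    In degree zero, the average over a period is invariant under the group, and
    a periodic function of average zero is [g (m + 1) - g m] for some periodic
    [g] by summation, hence is zero in the coinvariants ([homology0_mean]). *)

(** * Linear extension of maps on generators *)

Section ZmodMorphism.
Variables (U V W : zmodType) (f : U -> V).
Hypothesis fB : zmod_morphism f.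

Definition additive_of : {additive U -> V} :=
  HB.pack f (GRing.isZmodMorphism.Build _ _ f fB).

Lemma morph0 : f 0 = 0. Proof. exact: (raddf0 additive_of). Qed.
Lemma morphN x : f (- x) = - f x. Proof. exact: (raddfN additive_of). Qed.
Lemma morphD x y : f (x + y) = f x + f y.
Proof. exact: (raddfD additive_of). Qed.
Lemma morphMz x z : f (x *~ z) = f x *~ z.
Proof. exact: (raddfMz additive_of). Qed.
Lemma morph_sum I (r : seq I) (P : pred I) (F : I -> U) :
  f (\sum_(i <- r | P i) F i) = \sum_(i <- r | P i) f (F i).
Proof. exact: (raddf_sum additive_of). Qed.

Lemma morph_comp (g : V -> W) :
  zmod_morphism g -> zmod_morphism (g \o f).
Proof. by move=> gB x y; rewrite /= fB gB. Qed.

End ZmodMorphism.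

Lemma sub_morph (U V : zmodType) (f g : U -> V) :
  zmod_morphism f -> zmod_morphism g -> zmod_morphism (fun x => f x - g x).
Proof. by move=> fB gB x y; rewrite fB gB !opprD !opprK addrACA. Qed.

Lemma malg_morph_ext (K : choiceType) (A V : zmodType)
    (f g : {malg A[K]} -> V) :
  zmod_morphism f -> zmod_morphism g ->
  (forall k a, f << a *g k >> = g << a *g k >>) -> f =1 g.
Proof.
move=> fB gB fg c; rewrite (monalgE c) (morph_sum fB) (morph_sum gB).
by apply: eq_bigr => k _; exact: fg.
Qed.

Section Lift.
Variables (K : choiceType) (A V : zmodType) (phi : K -> A -> V).
Hypothesis phiB : forall k, zmod_morphism (phi k).

(** The universal property of the free module with coefficients in [A]: a
    family of additive maps out of [A], one for each generator, glues together.
    *)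
Definition malg_lift (c : {malg A[K]}) : V := \sum_(k <- msupp c) phi k c@_k.

Lemma malg_liftEw (c : {malg A[K]}) (D : {fset K}) : (msupp c `<=` D)%fset ->
  malg_lift c = \sum_(k <- D) phi k c@_k.
Proof.
move=> cD; apply: big_fset_incl cD _ => k _ /mcoeff_outdom ->.
exact: morph0.
Qed.

Lemma malg_lift_morph : zmod_morphism malg_lift.
Proof.
move=> c d; pose D := (msupp c `|` msupp d)%fset.
rewrite (malg_liftEw (fsubsetUl _ _ : msupp c `<=` D)%fset).
rewrite (malg_liftEw (fsubsetUr _ _ : msupp d `<=` D)%fset).
rewrite (malg_liftEw (msuppB_le c d)) -sumrB.
by apply: eq_bigr => k _; rewrite mcoeffB phiB.
Qed.

Lemma malg_liftU k a : malg_lift << a *g k >> = phi k a.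
Proof. by rewrite (malg_liftEw msuppU_le) big_seq_fset1 mcoeffUU. Qed.

End Lift.

Lemma malg_lift_ext (K : choiceType) (A V : zmodType) (phi psi : K -> A -> V) :
  (forall k, phi k =1 psi k) -> malg_lift phi =1 malg_lift psi.
Proof. by move=> e c; apply: eq_bigr => k _; rewrite e. Qed.

Lemma mulrz_morph (V : zmodType) (v : V) : zmod_morphism (fun z => v *~ z).
Proof. by move=> x y; rewrite mulrzBr. Qed.

Lemma monalgU_morph (K : choiceType) (A : zmodType) (k : K) :
  zmod_morphism (fun a : A => << a *g k >>).
Proof. by move=> x y; rewrite monalgUB. Qed.

Section RegularModule.
Variable G : groupType.

(** The group ring, with the action [g . x = x * g^-1]. Left modules are
    regarded as right modules through [m g = g^-1 m] in the bar complex, and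
    with this action the complex with coefficients in [group_ring] is the bar
    resolution itself. *)
Definition group_ring : Type := {malg int[G]}.
HB.instance Definition _ := GRing.Zmodule.on group_ring.

Definition group_ring_act (g : G) : group_ring -> group_ring :=
  malg_lift (fun k z => << z *g (k * g^-1)%g >>).

Lemma group_ring_act_morph g : zmod_morphism (group_ring_act g).
Proof. by apply: malg_lift_morph => k; exact: monalgU_morph. Qed.

Lemma group_ring_actU g k z :
  group_ring_act g << z *g k >> = << z *g (k * g^-1)%g >>.
Proof. by rewrite /group_ring_act malg_liftU // => {}k;
  exact: monalgU_morph. Qed.

Lemma group_ring_act1 c : group_ring_act 1%g c = c.
Proof.
move: c; apply: (@malg_morph_ext _ _ _ _ id (group_ring_act_morph 1%g)) => // k
  z.
by rewrite group_ring_actU invg1 mulg1.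
Qed.

Lemma group_ring_actM g h c :
  group_ring_act (g * h)%g c = group_ring_act g (group_ring_act h c).
Proof.
move: c; apply: (malg_morph_ext (group_ring_act_morph _)) => [|k z].
  by apply: morph_comp; exact: group_ring_act_morph.
by rewrite !group_ring_actU invgM mulgA.
Qed.

Lemma group_ring_actD g : {morph group_ring_act g : c d / c + d}.
Proof. exact: morphD (group_ring_act_morph g). Qed.

HB.instance Definition _ :=
  isGModule.Build G group_ring group_ring_act1 group_ring_actM group_ring_actD.

Lemma mcoeff_gact_group_ring g (c : group_ring) k :
  (gact g c : {malg int[G]})@_k = (c : {malg int[G]})@_(k * g)%g.
Proof.
move: c; apply: (@malg_morph_ext _ _ _ (fun c => (group_ring_act g c)@_k)) =>
  [x y|x y|h z].
- by rewrite group_ring_act_morph mcoeffB.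
- by rewrite mcoeffB.
rewrite group_ring_actU !mcoeffU; congr (_ *+ nat_of_bool _).
by apply/eqP/eqP => [<-|->]; rewrite -mulgA ?mulgV ?mulVg mulg1.
Qed.

Lemma gactU g k z :
  gact g (<< z *g k >> : group_ring) = << z *g (k * g^-1)%g >>.
Proof. exact: group_ring_actU. Qed.

Section Orbit.
Variables (M : gmodType G) (m : M).

(** The homomorphism of modules from the group ring that sends [1] to [m]; the
    group ring is free on [1]. *)
Definition orbit : group_ring -> M :=
  malg_lift (fun g z => gact g^-1%g m *~ z).

Lemma orbit_morph : zmod_morphism orbit.
Proof. by apply: malg_lift_morph => g; exact: mulrz_morph. Qed.

Lemma orbitU g z : orbit << z *g g >> = gact g^-1%g m *~ z.
Proof. by rewrite /orbit malg_liftU // => {}g; exact: mulrz_morph. Qed.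

End Orbit.

End RegularModule.

(** * Equivariant maps between free modules, with coefficients *)

Notation tens M X := {malg (M : zmodType)[(X : choiceType)]}.

Section Operators.
Variable G : groupType.
Local Notation ZG := (group_ring G).

Definition unit_gen (X : choiceType) (x : X) : tens ZG X :=
  << (<< 1 *g 1%g >> : ZG) *g x >>.

(** An element of the free module [tens ZG X] is a formal combination of
    generators with coefficients in the group ring; replacing [1] by [m]
    evaluates it with coefficients in [M]. *)
Definition orbit_map (M : gmodType G) (X : choiceType) (m : M) :
    tens ZG X -> tens M X :=
  malg_lift (fun x a => << orbit m a *g x >>).

Lemma orbit_map_morph (M : gmodType G) (X : choiceType) (m : M) :
  zmod_morphism (@orbit_map M X m).
Proof.
by apply: malg_lift_morph => x a b; rewrite orbit_morph monalgUB.
Qed.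

Arguments orbit_map_morph {M X} m.

Lemma orbit_mapU (M : gmodType G) (X : choiceType) (m : M) (x : X) a :
  orbit_map m << a *g x >> = << orbit m a *g x >>.
Proof.
by rewrite /orbit_map malg_liftU // => {a}y a b; rewrite orbit_morph monalgUB.
Qed.

(** The group ring is itself free as an abelian group, so an additive map out
    of [tens ZG X] is determined by the elements [h x] for [h] in the group and
    [x] in [X]. *)
Lemma tens_morph_ext (X : choiceType) (V : zmodType) (f g : tens ZG X -> V) :
  zmod_morphism f -> zmod_morphism g ->
  (forall (h : G) x, f << (<< 1 *g h >> : ZG) *g x >> = g <<
    (<< 1 *g h >> : ZG) *g x >>) -> f =1 g.
Proof.
move=> fB gB fg; apply: malg_morph_ext => // x.
apply: (@malg_morph_ext _ _ _ (fun a => f << a *g x >>)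
                              (fun a => g << a *g x >>)).
- by move=> a b; rewrite monalgUB fB.
- by move=> a b; rewrite monalgUB gB.
move=> h z.
have -> : << z *g h >> = << 1 *g h >> *~ z :> ZG.
  by rewrite -(morphMz (monalgU_morph _)) -mulrzr mul1r intz.
by rewrite (morphMz (monalgU_morph _)) (morphMz fB) (morphMz gB) fg.
Qed.

Lemma orbit_map_coefB (M : gmodType G) (X : choiceType) (w : tens ZG X) :
  zmod_morphism (fun m : M => orbit_map m w).
Proof.
move=> m p.
apply: (@tens_morph_ext _ _ (orbit_map (m - p))
  (fun w => orbit_map m w - orbit_map p w)).
- exact: orbit_map_morph.
- by apply: sub_morph; exact: orbit_map_morph.
by move=> h x; rewrite !orbit_mapU !orbitU !mulr1z gactB monalgUB.
Qed.

Lemma orbit_map_gen (M : gmodType G) (X : choiceType) (m : M) (x : X) :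
  orbit_map m (unit_gen x) = << m *g x >>.
Proof. by rewrite orbit_mapU orbitU invg1 gact1. Qed.

Section Op.
Variables (X Y : choiceType) (phi : X -> tens ZG Y).

(** An equivariant map between free modules is given by the images [phi x] of
    the generators, and acts with coefficients in any module [M] by sending [m
    x] to the evaluation of [phi x] at [m]. All identities between such maps
    can thus be checked over the group ring and transferred to [M]. *)
Definition extend (M : gmodType G) : tens M X -> tens M Y :=
  malg_lift (fun x m => orbit_map m (phi x)).

Lemma extend_morph M : zmod_morphism (@extend M).
Proof. by apply: malg_lift_morph => x; exact: orbit_map_coefB. Qed.

Lemma extendU (M : gmodType G) x (m : M) : extend << m *g x >> = orbit_map m
  (phi x).
Proof. by rewrite /extend malg_liftU // => {}x; exact: orbit_map_coefB. Qed.

Lemma orbit_map_id (w : tens ZG Y) : orbit_map (<< 1 *g 1%g >> : ZG) w = w.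
Proof.
apply: (@tens_morph_ext _ _ _ id) w => // [|h x]; first exact: orbit_map_morph.
rewrite orbit_mapU orbitU gactU invgK mul1g.
by rewrite mulr1z.
Qed.

Lemma extend_gen x : extend (unit_gen x) = phi x.
Proof. by rewrite extendU orbit_map_id. Qed.

End Op.

Arguments extend_morph {X Y} phi M.

Lemma extend0 (M : gmodType G) (X Y : choiceType) (phi : X -> tens ZG Y) :
  extend phi (0 : tens M X) = 0.
Proof. exact: morph0 (extend_morph phi M). Qed.

Lemma extendD (M : gmodType G) (X Y : choiceType) (phi : X -> tens ZG Y)
    (c d : tens M X) : extend phi (c + d) = extend phi c + extend phi d.
Proof. exact: morphD (extend_morph phi M) c d. Qed.

Lemma orbit_map_comp (M : gmodType G) (X : choiceType) (m : M) g
  (w : tens ZG X) :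
  orbit_map m (orbit_map (<< 1 *g g >> : ZG) w) = orbit_map (gact g^-1%g m) w.
Proof.
apply: (@tens_morph_ext _ _ (orbit_map m \o _)) w.
- by apply: morph_comp; exact: orbit_map_morph.
- exact: orbit_map_morph.
move=> h x /=; rewrite !orbit_mapU !orbitU mulr1z gactU orbitU.
by rewrite invgK invgM gactM.
Qed.

(** Naturality in the coefficients; this is what makes extensions compose. *)
Lemma extend_orbit_map (M : gmodType G) (X Y : choiceType)
  (psi : X -> tens ZG Y) (m : M) w :
  extend psi (orbit_map m w) = orbit_map m (extend psi w).
Proof.
move: w; apply: (@tens_morph_ext _ _ (extend psi (M := M) \o orbit_map m)
  (orbit_map m \o extend psi (M := ZG))).
- exact: (morph_comp (@orbit_map_morph M X m) (extend_morph psi M)).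
- exact: (morph_comp (extend_morph psi ZG) (@orbit_map_morph M Y m)).
by move=> h x; rewrite /= orbit_mapU !extendU orbitU mulr1z orbit_map_comp.
Qed.

Lemma extend_comp (M : gmodType G) (X Y Z : choiceType) (psi : Y -> tens ZG Z)
    (phi : X -> tens ZG Y) (c : tens M X) :
  extend psi (extend phi c) = extend (fun x => extend psi (phi x)) c.
Proof.
move: c; apply: (@malg_morph_ext _ _ _
  (extend psi (M := M) \o extend phi (M := M))).
- exact: (morph_comp (extend_morph phi M) (extend_morph psi M)).
- exact: extend_morph.
by move=> x m; rewrite /= !extendU extend_orbit_map.
Qed.

Lemma extend_id (M : gmodType G) (X : choiceType) (c : tens M X) : extend
  (@unit_gen X) c = c.
Proof.
apply: (@malg_morph_ext _ _ _ _ id) c => // [|x m]; first exact: extend_morph.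
by rewrite extendU orbit_map_gen.
Qed.

Lemma eq_extend (M : gmodType G) (X Y : choiceType) (phi psi : X -> tens ZG Y) :
  phi =1 psi -> extend phi (M := M) =1 extend psi (M := M).
Proof. by move=> e c; apply: malg_lift_ext => x m; rewrite e. Qed.

Lemma extend_cst0 (M : gmodType G) (X Y : choiceType) (c : tens M X) :
  extend (fun=> 0 : tens ZG Y) c = 0.
Proof.
move: c; apply: (@malg_morph_ext _ _ _ _ (fun=> 0)) => [||x m].
- exact: extend_morph.
- by move=> a b; rewrite subrr.
by rewrite extendU (morph0 (orbit_map_morph m)).
Qed.

Lemma extend_sub (M : gmodType G) (X Y : choiceType) (phi psi : X -> tens ZG Y)
  (c : tens M X) :
  extend (fun x => phi x - psi x) c = extend phi c - extend psi c.
Proof.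
apply: (@malg_morph_ext _ _ _ _ (fun c => extend phi c - extend psi c)) c.
- exact: extend_morph.
- by apply: sub_morph; exact: extend_morph.
by move=> x m; rewrite !extendU orbit_map_morph.
Qed.

End Operators.

(** * Comparison of free resolutions *)

Section Augmentation.
Variable G : groupType.
Local Notation ZG := (group_ring G).

Definition coef_sum (a : ZG) : int := malg_lift (fun (_ : G) (z : int) => z) a.

Lemma coef_sum_morph : zmod_morphism coef_sum.
Proof. by apply: malg_lift_morph => g a b. Qed.

Lemma coef_sumU g z : coef_sum << z *g g >> = z.
Proof. by rewrite /coef_sum malg_liftU // => k a b. Qed.

Lemma coef_sum_gact g a : coef_sum (gact g a) = coef_sum a.
Proof.
move: a; apply: malg_morph_ext => [a b|a b|k z].
- by rewrite gactB coef_sum_morph.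
- exact: coef_sum_morph.
by rewrite gactU !coef_sumU.
Qed.

Definition aug (X : choiceType) : tens ZG X -> int :=
  malg_lift (fun _ a => coef_sum a).

Lemma aug_morph (X : choiceType) : zmod_morphism (@aug X).
Proof. by apply: malg_lift_morph => x; exact: coef_sum_morph. Qed.

Lemma augU (X : choiceType) (x : X) a : aug << a *g x >> = coef_sum a.
Proof. by rewrite /aug malg_liftU // => y; exact: coef_sum_morph. Qed.

Lemma aug_gen (X : choiceType) (x : X) : aug (unit_gen G x) = 1.
Proof. by rewrite augU coef_sumU. Qed.

Lemma aug_orbit_map (X : choiceType) (a : ZG) (w : tens ZG X) :
  aug (orbit_map a w) = coef_sum a * aug w.
Proof.
move: w; apply: tens_morph_ext => [v w|v w|h x].
- by rewrite orbit_map_morph aug_morph.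
- by rewrite aug_morph mulrBr.
by rewrite orbit_mapU !augU orbitU mulr1z coef_sum_gact coef_sumU mulr1.
Qed.

Lemma eq_aug_extend (X Y Z : choiceType) (phi : X -> tens ZG Y)
    (psi : X -> tens ZG Z) (c : tens ZG X) :
  (forall x, aug (phi x) = aug (psi x)) -> aug (extend phi c) = aug
    (extend psi c).
Proof.
move=> e; move: c; apply: malg_morph_ext => [a b|a b|x a].
- by rewrite extend_morph aug_morph.
- by rewrite extend_morph aug_morph.
by rewrite !extendU !aug_orbit_map e.
Qed.

End Augmentation.

(** Complexes of free modules over the group ring, described by their bases; an
    element of the complex with coefficients in [M] in degree [k] lies in [tens
    M (X k)]. *)
Record free_complex (G : groupType) := FreeComplex {
  basis :> nat -> choiceType;
  base_point : basis 0;
  differential : forall n, basis n.+1 -> tens (group_ring G) (basis n);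
  differentialK : forall n x, extend (@differential n) (@differential n.+1 x) =
    0;
  aug_differential : forall x, aug (@differential 0 x) = 0
}.

Lemma differential_square (G : groupType) (X : free_complex G) (M : gmodType G)
  n
    (c : tens M (X n.+2)) : extend (@differential _ X n)
      (extend (@differential _ X n.+1) c) = 0.
Proof. by rewrite extend_comp (eq_extend (@differentialK _ X n)) extend_cst0.
  Qed.

(** Exactness over the group ring, including at the augmentation, so that an
    acyclic [free_complex] is a free resolution of the integers. *)
Definition acyclic (G : groupType) (X : free_complex G) : Prop :=
  (forall z : tens (group_ring G) (X 0%N), aug z = 0 ->
     exists w, extend (@differential _ X 0) w = z) /\
  (forall n (z : tens (group_ring G) (X n.+1)),
    extend (@differential _ X n) z = 0 ->
     exists w, extend (@differential _ X n.+1) w = z).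

Section Solve.
Variables (G : groupType) (Y : free_complex G).
Local Notation ZG := (group_ring G).

(** An arbitrary preimage under the differential, if there is one; the
    comparison maps are built from it by recursion on the degree. *)
Definition some_preimage n (z : tens ZG (Y n)) : tens ZG (Y n.+1) :=
  xget 0 [set w | extend (@differential _ Y n) w = z].

Lemma some_preimageK n (z : tens ZG (Y n)) :
  (exists w, extend (@differential _ Y n) w = z) -> extend
    (@differential _ Y n) (some_preimage z) = z.
Proof. by move=> ex; exact: (xgetPex 0 ex). Qed.

End Solve.

Section NullHomotopy.
Variables (G : groupType) (X Y : free_complex G).
Local Notation ZG := (group_ring G).
Variable alpha : forall n, X n -> tens ZG (Y n).
Hypothesis acY : acyclic Y.
Hypothesis alpha_chain : forall n (x : X n.+1),
  extend (@differential _ Y n) (alpha x) = extend (@alpha n) (differential x).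
Hypothesis alpha_aug : forall x, aug (@alpha 0 x) = 0.

(** A chain map [alpha] to a resolution that vanishes under the augmentation is
    null homotopic: the difference that remains after the previous stage is a
    cycle, and any preimage of it can serve as the next stage. *)
Fixpoint homotopy n : X n -> tens ZG (Y n.+1) :=
  match n with
  | 0 => fun x => some_preimage (alpha x)
  | k.+1 => fun x => some_preimage (alpha x - extend (@homotopy k)
    (differential x))
  end.

Lemma homotopyE n (x : X n.+1) :
  extend (@differential _ Y n.+1) (homotopy x) = alpha x - extend (@homotopy n)
    (differential x).
Proof.
have [acY0 acYS] := acY.
have homotopy0 (y : X 0%N) : extend (@differential _ Y 0) (homotopy y) = alpha
  y.
  by apply: some_preimageK; apply: acY0.
elim: n x => [|n IH] x; apply: some_preimageK; apply: acYS.
  rewrite extend_morph alpha_chain extend_comp.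
  by rewrite (eq_extend homotopy0) subrr.
rewrite extend_morph alpha_chain extend_comp (eq_extend IH) extend_sub
  -extend_comp differentialK.
by rewrite extend0 subr0 subrr.
Qed.

Lemma homotopy_cycle (M : gmodType G) n (c : tens M (X n.+1)) :
  extend (@differential _ X n) c = 0 ->
  exists w, extend (@differential _ Y n.+1) w = extend (@alpha n.+1) c.
Proof.
move=> c0; exists (extend (@homotopy n.+1) c).
rewrite extend_comp (eq_extend (@homotopyE n)) extend_sub -extend_comp c0.
by rewrite extend0 subr0.
Qed.

End NullHomotopy.

Section Comparison.
Variables (G : groupType) (X Y : free_complex G).
Local Notation ZG := (group_ring G).
Hypothesis acY : acyclic Y.

(** Freeness of the source and exactness of the target give a chain map that
    preserves the augmentation. *)
Fixpoint comparison_map n : X n -> tens ZG (Y n) :=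
  match n with
  | 0 => fun x => unit_gen G (base_point Y)
  | k.+1 => fun x => some_preimage (extend (@comparison_map k) (differential x))
  end.

Lemma comparison_map_chain n (x : X n.+1) :
  extend (@differential _ Y n) (comparison_map x) = extend (@comparison_map n)
    (differential x).
Proof.
have [acY0 acYS] := acY.
elim: n x => [|n IH] x; apply: some_preimageK.
  apply: acY0; rewrite -[RHS](aug_differential x)
    -[in RHS](extend_id (differential x)).
  by apply: eq_aug_extend => y; rewrite !aug_gen.
apply: acYS; rewrite extend_comp (eq_extend IH) -extend_comp differentialK.
exact: extend0.
Qed.

End Comparison.

(** Going from [X] to [Y] and back differs from the identity by a chain map
    that vanishes under the augmentation, hence is null homotopic. *)
Theorem comparison_inverse (G : groupType) (X Y : free_complex G)
    (acX : acyclic X) (acY : acyclic Y) (M : gmodType G) n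
    (c : tens M (X n.+1)) :
  extend (@differential _ X n) c = 0 ->
  exists w, extend (@differential _ X n.+1) w =
    extend (@comparison_map _ Y X n.+1) (extend (@comparison_map _ X Y n.+1) c)
      - c.
Proof.
move=> c0.
pose alpha k (x : X k) :=
  extend (@comparison_map _ Y X k) (@comparison_map _ X Y k x) - unit_gen G x.
have [k x||w wE] := @homotopy_cycle G X X alpha acX _ _ M n c c0.
- rewrite extend_morph extend_gen extend_comp
    (eq_extend (@comparison_map_chain _ Y X acX k)).
  rewrite -extend_comp comparison_map_chain // extend_sub extend_id extend_comp.
  by [].
- by move=> x; rewrite /alpha aug_morph /= extend_gen !aug_gen subrr.
by exists w; rewrite wE extend_sub extend_id extend_comp.
Qed.

(** * The bar resolution *)

Section BarResolution.
Variable G : groupType.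
Local Notation ZG := (group_ring G).
Local Notation bar_basis n := {ffun 'I_n -> G}.

Definition bar_diff n (t : bar_basis n.+1) : tens ZG (bar_basis n) :=
  boundary (unit_gen G t : chain ZG n.+1).

Lemma orbit_face_coef (M : gmodType G) n (i : 'I_n.+2) (t : bar_basis n.+1)
  (m : M) :
  orbit m (face_coef i t (<< 1 *g 1%g >> : ZG)) = face_coef i t m.
Proof.
rewrite /face_coef; case: ifP => _; last by rewrite orbitU mulr1z invg1 gact1.
by rewrite gactU orbitU mulr1z invgK mul1g.
Qed.

(** The bar complex with coefficients comes from a complex of free modules over
    the group ring. *)
Lemma boundaryE (M : gmodType G) n (c : chain M n.+1) :
  boundary c = extend (@bar_diff n) c.
Proof.
move: c; apply: (@malg_morph_ext _ _ _ (@boundary G M n)) => [||t m].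
- exact: boundaryB.
- exact: extend_morph.
rewrite boundaryU extendU /bar_diff /unit_gen boundaryU
  (morph_sum (orbit_map_morph m)).
apply: eq_bigr => i _.
by rewrite (morphMz (orbit_map_morph m)) orbit_mapU orbit_face_coef.
Qed.

Lemma bar_diff_diff n (t : bar_basis n.+2) : extend (@bar_diff n) (bar_diff t)
  = 0.
Proof. by rewrite -boundaryE boundary_boundary. Qed.

Lemma aug_bar_diff (t : bar_basis 1) : aug (bar_diff t) = 0.
Proof.
rewrite /bar_diff /unit_gen boundaryU !big_ord_recl big_ord0 addr0 expr0 expr1
  mulrNz !mulr1z.
by rewrite aug_morph !augU /face_coef /= coef_sum_gact subrr.
Qed.

Definition bar_resolution : free_complex G :=
  @FreeComplex G (fun n => bar_basis n) [ffun i : 'I_0 => 1%g] bar_diff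
    bar_diff_diff aug_bar_diff.

Definition fcons n (g : G) (t : bar_basis n) : bar_basis n.+1 :=
  [ffun i => if unlift ord0 i is Some j then t j else g].

Lemma fcons0 n g (t : bar_basis n) : fcons g t ord0 = g.
Proof. by rewrite ffunE unlift_none. Qed.

Lemma fconsS n g (t : bar_basis n) j : fcons g t (lift ord0 j) = t j.
Proof. by rewrite ffunE liftK. Qed.

Lemma face0_fcons n g (t : bar_basis n) : face ord0 (fcons g t) = t.
Proof. by apply/ffunP => j; rewrite ffunE /= fconsS. Qed.

Lemma face1_fcons n g (t : bar_basis n.+1) :
  face (lift ord0 ord0) (fcons g t) = fcons (g * t ord0)%g (face ord0 t).
Proof.
apply/ffunP => j; have [k ->|->] := unliftP ord0 j.
  by rewrite fconsS ffunE [face ord0 t k]ffunE /= fconsS.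
rewrite fcons0 ffunE /=.
have -> : widen_ord (leqnSn n.+1) ord0 = ord0 by apply/val_inj.
by rewrite fcons0 fconsS.
Qed.

Lemma faceS_fcons n g (t : bar_basis n.+1) (i : 'I_n.+1) :
  face (lift ord0 (lift ord0 i)) (fcons g t) = fcons g (face (lift ord0 i) t).
Proof.
apply/ffunP => j; have [k ->|->] := unliftP ord0 j; last first.
  rewrite fcons0 ffunE /=.
  have -> : widen_ord (leqnSn n.+1) ord0 = ord0 by apply/val_inj.
  by rewrite fcons0.
rewrite fconsS !ffunE liftK.
have -> : widen_ord (leqnSn n.+1) (lift ord0 k) = lift ord0
  (widen_ord (leqnSn n) k).
  by apply/val_inj.
by rewrite liftK !lift0 /= !ltnS !eqSS.
Qed.

(** The usual contraction of the bar resolution, sending [g [t1 | ... | tn]] to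
    [[g | t1 | ... | tn]]. *)
Definition bar_htpy n : tens ZG (bar_basis n) -> tens ZG (bar_basis n.+1) :=
  malg_lift (fun t a => malg_lift (fun g z => unit_gen G (fcons g t) *~ z) a).

Lemma bar_htpy_morph n : zmod_morphism (@bar_htpy n).
Proof. by do 2![apply: malg_lift_morph => ?]; exact: mulrz_morph. Qed.

Lemma bar_htpyU n g (t : bar_basis n) :
  bar_htpy << (<< 1 *g g >> : ZG) *g t >> = unit_gen G (fcons g t).
Proof.
rewrite /bar_htpy malg_liftU => [|s]; last first.
  by apply: malg_lift_morph => ?; exact: mulrz_morph.
by rewrite malg_liftU // => h; exact: mulrz_morph.
Qed.

Lemma bar_htpy_diff0 (z : tens ZG (bar_basis 0)) :
  boundary (bar_htpy z) = z - unit_gen G (base_point bar_resolution) *~ aug z.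
Proof.
move: z; apply: tens_morph_ext => [a b|a b|g t].
- by rewrite bar_htpy_morph boundaryB.
- by rewrite aug_morph mulrzBr !opprD !opprK addrACA.
rewrite bar_htpyU /unit_gen boundaryU !big_ord_recl big_ord0 addr0 expr0 expr1
  mulrNz !mulr1z.
rewrite augU coef_sumU mulr1z face0_fcons /face_coef /= fcons0.
rewrite gactU invgK mul1g.
by have -> : face (lift ord0 ord0) (fcons g t) = base_point bar_resolution by
  apply/ffunP => -[].
Qed.

Lemma bar_htpy_diff n (z : tens ZG (bar_basis n.+1)) :
  boundary (bar_htpy z) = z - bar_htpy (boundary z).
Proof.
move: z; apply: tens_morph_ext => [a b|a b|g t].
- by rewrite bar_htpy_morph boundaryB.
- by rewrite boundaryB bar_htpy_morph !opprD !opprK addrACA.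
rewrite bar_htpyU /unit_gen boundaryU big_ord_recl /= expr0 mulr1z face0_fcons.
rewrite {1}/face_coef /= fcons0 gactU invgK mul1g.
congr +%R; rewrite boundaryU (morph_sum (@bar_htpy_morph _)) -sumrN;
  apply: eq_bigr => i _.
rewrite (morphMz (@bar_htpy_morph _)) exprS mulN1r mulrNz.
rewrite {1}/face_coef /=; have [j ->|->] := unliftP ord0 i.
  by rewrite faceS_fcons /face_coef /= bar_htpyU.
by rewrite face1_fcons /face_coef /= gactU invgK bar_htpyU.
Qed.

Lemma bar_acyclic : acyclic bar_resolution.
Proof.
split=> [z z0|n z]; [exists (bar_htpy z)|rewrite -boundaryE => z0;
  exists (bar_htpy z)].
  by rewrite -[LHS]boundaryE bar_htpy_diff0 z0 mulr0z subr0.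
by rewrite -[LHS]boundaryE bar_htpy_diff z0 (morph0 (@bar_htpy_morph _)) subr0.
Qed.

End BarResolution.

(** * A small resolution for the infinite dihedral group *)

(** The two reflections [m |-> - m] and [m |-> 1 - m], which generate the
    infinite dihedral group as a free product of two groups of order two. *)
Definition reflection (b : bool) : Dinf := ((b : nat)%:Z, 1).

Lemma Z2_cases (a : 'Z_2) : a = 0 \/ a = 1.
Proof. by case: a => [[|[|//]] ?]; [left|right]; apply/val_inj. Qed.

Lemma mul_reflection m (a : 'Z_2) (b : bool) :
  (((m, a) : Dinf) * reflection b)%g =
    (m + (-1) ^+ (a : nat) * (b : nat)%:Z, a + 1).
Proof. by []. Qed.

Lemma reflectionK b : (reflection b * reflection b)%g = 1%g.
Proof.
rewrite mul_reflection expr1 mulN1r subrr; congr pair; exact/val_inj.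
Qed.

Lemma reflectionV b : (reflection b)^-1%g = reflection b.
Proof. by apply: (@mulgI _ (reflection b)); rewrite mulgV reflectionK. Qed.

Section SmallResolution.
Local Notation ZG := (group_ring Dinf).

Definition small_basis (n : nat) : choiceType := if n is 0 then unit else bool.

Definition small_proj n : bool -> small_basis n :=
  match n with 0 => fun=> tt | _.+1 => id end.

(** From degree [n.+1] to degree [n], the differential on the copy of the group
    ring indexed by [b] is [reflection b - 1] or [reflection b + 1] according
    to the parity of [n]. The two copies have a common target in degree zero
    only. *)
Definition small_diff n (b : bool) : tens ZG (small_basis n) :=
  << (<< 1 *g reflection b >> + << (-1) ^+ n.+1 *g 1%g >> : ZG) *g small_proj n
    b >>.

Section Coefficients.
Variable M : gmodType Dinf.

Lemma extend_small_diffU n b (m : M) : extend (@small_diff n) << m *g b >> =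
  << gact (reflection b) m + m *~ (-1) ^+ n.+1 *g small_proj n b >>.
Proof.
by rewrite extendU orbit_mapU (morphD (@orbit_morph _ _ _)) !orbitU reflectionV
  invg1 gact1.
Qed.

Lemma tens_boolE (c : tens M bool) :
  c = << c@_false *g false >> + << c@_true *g true >>.
Proof. by apply/malgP => -[]; rewrite mcoeffD !mcoeffU /= ?addr0 ?add0r. Qed.

Lemma mcoeff_small_diff n (c : tens M bool) b :
  (extend (@small_diff n.+1) c : tens M bool)@_b = gact (reflection b) c@_b +
    c@_b *~ (-1) ^+ n.
Proof.
rewrite [in LHS](tens_boolE c) extendD !extend_small_diffU.
by rewrite mcoeffD !mcoeffU; case: b; rewrite /= !exprS !mulN1r opprK ?addr0
  ?add0r.
Qed.

Lemma extend_small_diff0 (c : tens M bool) : extend (@small_diff 0) c =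
  << gact (reflection false) c@_false - c@_false +
    (gact (reflection true) c@_true - c@_true) *g tt >>.
Proof.
rewrite [in LHS](tens_boolE c) extendD !extend_small_diffU /=.
by rewrite !mulrN1z -monalgUD.
Qed.

End Coefficients.

Lemma small_diff_diff n b : extend (@small_diff n) (small_diff n.+1 b) = 0.
Proof.
rewrite extend_small_diffU; set v := (X in << X *g _ >>).
suff -> : v = 0 by rewrite monalgU0.
rewrite /v gactD !gactU mulgV reflectionV mul1g -[_ ^+ n.+2]signr_odd
  -[_ ^+ n.+1]signr_odd /=.
case: (odd n) => /=; rewrite ?expr0 ?expr1 ?mulr1z ?mulrN1z ?monalgUN.
  by rewrite addrA subrK subrr.
by rewrite [X in _ - X]addrC subrr.
Qed.

Lemma aug_small_diff b : aug (@small_diff 0 b) = 0.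
Proof. by rewrite augU (morphD (@coef_sum_morph _)) !coef_sumU expr1 subrr. Qed.

Definition small_resolution : free_complex Dinf :=
  @FreeComplex Dinf small_basis tt (fun n => @small_diff n)
    (fun n => @small_diff_diff n) aug_small_diff.

Section Exactness.
Variable M : gmodType Dinf.

(** The quotient of the [u] with [r u = - u] by the [r v - v] is the homology,
    in positive even degrees, of the subgroup of order two generated by [r]. *)
Definition odd_split := forall b (u : M), gact (reflection b) u = - u ->
  exists v, u = gact (reflection b) v - v.

Definition no_odd := forall u : M, (forall b, gact (reflection b) u = - u) -> u
  = 0.

Lemma small_exact_even n (c : tens M bool) : odd_split -> odd n ->
  extend (@small_diff n) c = 0 -> exists w, extend (@small_diff n.+1) w = c.
Proof.
move=> sp; case: n => // n /= en c0.
have sp' b : exists v, c@_b = gact (reflection b) v - v.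
  apply: sp; have := mcoeff_small_diff n c b.
  rewrite c0 mcoeff0 -signr_odd (negbTE en) mulr1z.
  by move/eqP; rewrite eq_sym addr_eq0 => /eqP.
have [v vE] := choice sp'.
exists (<< v false *g false >> + << v true *g true >>).
apply/malgP => b; rewrite mcoeff_small_diff mcoeffD !mcoeffU -signr_odd /= en
  mulrN1z.
by rewrite vE; case: b; rewrite /= ?addr0 ?add0r.
Qed.

(** In degree one the two components interact: a cycle gives [u] in [M], equal
    to [r v - v] for one reflection and to minus such an expression for the
    other, so that both reflections change the sign of [u] and [no_odd]
    applies. *)
Lemma small_cycle_odd n (c : tens M bool) : odd_split -> no_odd -> ~~ odd n ->
  extend (@small_diff n) c = 0 -> forall b, gact (reflection b) c@_b = c@_b.
Proof.
move=> sp nodd; case: n => [_|n /= /negPn on] c0 b; last first.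
  have := mcoeff_small_diff n c b; rewrite c0 mcoeff0 -signr_odd on mulrN1z.
  by move/eqP; rewrite eq_sym subr_eq0 => /eqP.
pose u b := gact (reflection b) c@_b - c@_b.
have rK b' (m : M) : gact (reflection b') (gact (reflection b') m) = m by
  rewrite -gactM reflectionK gact1.
have uN b' : gact (reflection b') (u b') = - u b' by rewrite /u gactB rK opprB.
have ue : u false = - u true.
  move/(congr1 (mcoeff tt)): c0; rewrite extend_small_diff0 mcoeffUU mcoeff0.
  by move/eqP; rewrite addr_eq0 => /eqP.
(* The two reflections change the sign of [u false], directly and through [u
   true]. *)
have u0 : u false = 0.
  apply: nodd => -[]; last exact: uN.
  by rewrite ue (morphN (@gactB _ _ _)) uN.
have {ue u0 uN} u0 b' : u b' = 0.
  by case: b' => //; rewrite -[LHS]opprK -ue u0 oppr0.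
by apply/eqP; rewrite -subr_eq0; apply/eqP/u0.
Qed.

Lemma small_boundary_odd n (c : tens M bool) : ~~ odd n ->
  (exists w, extend (@small_diff n.+1) w = c) <->
  (forall b, exists v : M, c@_b = gact (reflection b) v + v).
Proof.
move=> en; split=> [[w <-] b|sp].
  exists (w : tens M bool)@_b.
  by rewrite mcoeff_small_diff -signr_odd (negbTE en) mulr1z.
have [v vE] := choice sp.
exists (<< v false *g false >> + << v true *g true >>).
apply/malgP => b; rewrite mcoeff_small_diff mcoeffD !mcoeffU -signr_odd
  (negbTE en) mulr1z.
by rewrite vE; case: b; rewrite /= ?addr0 ?add0r.
Qed.

End Exactness.

(** The translations represent the cosets of the subgroup generated by either
    reflection. Cutting an element of the group ring down to them solves the
    equations [u = r v - v] and [u = r v + v]. *)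
Definition translation_part (u : ZG) : ZG :=
  malg_lift (fun (k : Dinf) (z : int) => if k.2 == 0 then << z *g k >> else 0)
    u.

Lemma mcoeff_translation_part (u : ZG) (k : Dinf) :
  (translation_part u : {malg int[Dinf]})@_k = if k.2 == 0 then
    (u : {malg int[Dinf]})@_k else 0.
Proof.
have hB (h : Dinf) : zmod_morphism (fun z : int => if h.2 == 0 then << z *g h
  >> else 0 : ZG).
  by case: (h.2 == 0) => a b; [exact: monalgUB|rewrite subrr].
have translation_partB : zmod_morphism translation_part := malg_lift_morph hB.
move: u; apply: (@malg_morph_ext _ _ _ (fun u => (translation_part u)@_k)
  (fun u : {malg int[Dinf]} => if k.2 == 0 then u@_k else 0)) => [a b|a b|h z].
- by rewrite translation_partB mcoeffB.
- by case: (k.2 == 0); rewrite ?mcoeffB ?subrr.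
rewrite [translation_part _](malg_liftU hB) mcoeffU; have [->|hk] := eqVneq h k.
  by case: ifP; rewrite ?mcoeffUU ?mcoeff0.
by rewrite mulr0n if_same; case: ifP => _; rewrite ?mcoeffU ?mcoeff0 //
  (negbTE hk).
Qed.

Lemma gact_translation_part b (u : ZG) (k : Dinf) :
  (gact (reflection b) (translation_part u) : {malg int[Dinf]})@_k =
  if k.2 == 0 then 0 else (gact (reflection b) u : {malg int[Dinf]})@_k.
Proof.
rewrite [LHS]mcoeff_gact_group_ring mcoeff_translation_part
  [in RHS]mcoeff_gact_group_ring.
have -> : (k * reflection b)%g.2 = k.2 + 1 by [].
by case: (Z2_cases k.2) => ->.
Qed.

Lemma group_ring_odd_split : odd_split ZG.
Proof.
move=> b u uN; exists (- translation_part u).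
rewrite (morphN (@gactB _ _ _)) opprK; apply/malgP => k.
rewrite mcoeffD mcoeffN gact_translation_part mcoeff_translation_part uN
  mcoeffN.
by case: ifP => _; rewrite ?opprK ?addr0 // oppr0 add0r.
Qed.

Lemma group_ring_even_split b (u : ZG) : gact (reflection b) u = u ->
  exists v : ZG, u = gact (reflection b) v + v.
Proof.
move=> uE; exists (translation_part u); apply/malgP => k.
rewrite mcoeffD gact_translation_part mcoeff_translation_part uE.
by case: ifP => _; rewrite ?addr0 ?add0r.
Qed.

(** The product of the two reflections is a translation, so the coefficients of
    such an element are constant along translations; its support being finite,
    they vanish. *)
Lemma group_ring_no_odd : no_odd ZG.
Proof.
move=> u uN; apply/malgP => k.
have uE (b : bool) m a : u@_((m, a) : Dinf) = -
  u@_((m + (-1) ^+ (a : nat) * (b : nat)%:Z, a + 1) : Dinf).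
  have /(congr1 (mcoeff ((m, a) : Dinf))) := uN b;
    rewrite mcoeff_gact_group_ring mul_reflection mcoeffN.
  by move=> ->; rewrite opprK.
have u01 m : u@_((m, 0) : Dinf) = - u@_((m, 1) : Dinf).
  by rewrite (uE false) mulr0 addr0 add0r.
have uS m : u@_((m + 1, 0) : Dinf) = u@_((m, 0) : Dinf).
  by rewrite u01 [RHS](uE true) expr0 mul1r add0r.
have uD m j : u@_((m + j%:Z, 0) : Dinf) = u@_((m, 0) : Dinf).
  elim: j => [|j IH]; first by rewrite addr0.
  have -> : m + j.+1%:Z = m + j%:Z + 1 by lia.
  by rewrite uS.
have u0 m : u@_((m, 0) : Dinf) = 0.
  apply/eqP; apply/negPn/negP => um.
  (* More translates of [m] than the support has elements. *)
  pose s := [seq ((m + (j : nat)%:Z, 0) : Dinf) | j <- iota 0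
    (size (msupp u)).+1].
  have: (size s <= size (msupp u))%N.
    apply: uniq_leq_size => [|k' /mapP[j _ ->]];
      last by rewrite -mcoeff_neq0 uD.
    by rewrite map_inj_uniq ?iota_uniq // => i j [/addrI[]].
  by rewrite size_map size_iota ltnn.
rewrite mcoeff0; case: k => m a; case: (Z2_cases a) => -> //.
by rewrite -[LHS]opprK -u01 u0 oppr0.
Qed.

Lemma Dinf_connected (P : Dinf -> Prop) : P 1%g ->
  (forall g b, P g -> P (g * reflection b)%g) -> forall g, P g.
Proof.
move=> P1 Pr [m a].
have P01 m' : P (m', 0) -> P (m', 1).
  by move/(Pr _ false); rewrite mul_reflection mulr0 addr0 add0r.
have P10 m' : P (m', 1) -> P (m', 0).
  move/(Pr _ false); rewrite mul_reflection mulr0 addr0.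
  by have -> : 1 + 1 = 0 :> 'Z_2 by exact/val_inj.
have P0 : P (m, 0).
  elim/int_rec: m => // j IH.
    apply: P10; move/(Pr _ true): IH; rewrite mul_reflection expr0 mul1r add0r.
    by have -> : j.+1%:Z = j%:Z + 1 by lia.
  move/P01/(Pr _ true): IH; rewrite mul_reflection expr1 mulN1r.
  have -> : 1 + 1 = 0 :> 'Z_2 by exact/val_inj.
  by have -> : - j.+1%:Z = - j%:Z - 1 by lia.
by case: (Z2_cases a) => ->; [|apply: P01].
Qed.

(** Exactness in positive degrees is the computation for a general module,
    since the group ring has all the required splitting properties. In degree
    zero it says that the group is generated by the two reflections. *)
Lemma small_acyclic : acyclic small_resolution.
Proof.
split=> [z z0|n z z0].
  have ex (g : Dinf) : exists w : tens ZG bool, extend (@small_diff 0) w =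
      << (<< 1 *g g >> - << 1 *g 1%g >> : ZG) *g tt >>.
    move: g; apply: Dinf_connected => [|g b [w wE]].
      by exists 0; rewrite extend0 subrr monalgU0.
    exists (w + << (<< 1 *g g >> : ZG) *g b >>).
    rewrite extendD wE extend_small_diffU gactU reflectionV expr1 mulrN1z
      -monalgUD.
    by rewrite addrC addrA subrK.
  have [W WE] := choice ex.
  pose h : tens ZG unit -> tens ZG bool :=
    malg_lift (fun _ a => malg_lift (fun g z => W g *~ z) a).
  have hB : zmod_morphism h.
    by do 2![apply: malg_lift_morph => ?]; exact: mulrz_morph.
  exists (h z).
  have : extend (@small_diff 0) (h z) = z - unit_gen Dinf tt *~ aug z.
    move: {z0} z; apply: tens_morph_ext => [a b|a b|g []].
    - by rewrite hB extend_morph.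
    - by rewrite aug_morph mulrzBr !opprD !opprK addrACA.
    rewrite augU coef_sumU mulr1z /h malg_liftU => [|?]; last first.
      by apply: malg_lift_morph => ?; exact: mulrz_morph.
    rewrite malg_liftU => [|?]; last exact: mulrz_morph.
    by rewrite mulr1z WE monalgUB.
  by rewrite z0 mulr0z subr0.
have [on|en] := boolP (odd n); first exact: small_exact_even
  group_ring_odd_split on z0.
apply/(small_boundary_odd _ en) => b; apply: group_ring_even_split.
exact: small_cycle_odd group_ring_odd_split group_ring_no_odd en z0 b.
Qed.

End SmallResolution.

(** * Homology of the infinite dihedral group *)

Lemma cycle_valB (G : groupType) (M : gmodType G) n (z w : cycle M n) :
  cycle_val (z - w) = cycle_val z - cycle_val w.
Proof. exact: (raddfB (val : cycle M n -> chain M n)). Qed.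

(** All the homology groups below are computed by exhibiting an additive
    invariant of chains that detects the boundaries among the cycles. *)
Lemma homology_map (G : groupType) (M : gmodType G) n (A : zmodType)
    (g : chain M n -> A) : zmod_morphism g ->
  (forall z : cycle M n,
     g (cycle_val z) = 0 <-> exists c : chain M n.+1, boundary c = cycle_val z)
       ->
  exists2 f : {additive homology M n -> A}, injective f &
    forall z : cycle M n, f (\pi_(homology M n)%qT z) = g (cycle_val z).
Proof.
move=> gB g0.
have gE (z w : cycle M n) : \pi_(homology M n)%qT z = \pi_(homology M n)%qT w
  <->
    g (cycle_val z) = g (cycle_val w).
  have -> : \pi_(homology M n)%qT z = \pi_(homology M n)%qT w <-> z - w \in
    @is_boundary G M n.
    by rewrite Quotient.idealrBE; split=> [->|/eqP].
  rewrite unfold_in /is_boundary; split=> [/asboolP /g0|e].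
    by rewrite cycle_valB gB => /eqP; rewrite subr_eq0 => /eqP.
  by apply/asboolP/g0; rewrite cycle_valB gB e subrr.
pose f (x : homology M n) : A := g (cycle_val (repr x)).
have fpi z : f (\pi_(homology M n)%qT z) = g (cycle_val z) by apply/gE;
  rewrite reprK.
have fB : zmod_morphism f.
  move=> x y; rewrite -[x]reprK -[y]reprK -[_ - _]raddfB !fpi.
  by rewrite cycle_valB gB.
exists (additive_of fB) => // x y; rewrite -[x]reprK -[y]reprK /= !fpi.
by move/gE.
Qed.

Lemma bijective_of_inj_surj (A B : Type) (f : A -> B) :
  injective f -> (forall b, exists a, f a = b) -> bijective f.
Proof. by move=> fi /choice[g gK]; exists g => // a; apply: fi. Qed.

Section DihedralHomology.
Variable M : gmodType Dinf.
Local Notation ZG := (group_ring Dinf).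

Definition to_small n : chain M n.+1 -> tens M bool :=
  extend (@comparison_map Dinf (bar_resolution Dinf) small_resolution n.+1)
    (M := M).

Definition from_small n : tens M bool -> chain M n.+1 :=
  extend (@comparison_map Dinf small_resolution (bar_resolution Dinf) n.+1)
    (M := M).

Lemma to_small_morph n : zmod_morphism (@to_small n).
Proof. exact: extend_morph. Qed.

Lemma to_small_diff n (c : chain M n.+2) :
  to_small (boundary c) = extend (@small_diff n.+1) (to_small c).
Proof.
rewrite boundaryE /to_small !extend_comp; apply: eq_extend => t.
exact/esym/(@comparison_map_chain _ (bar_resolution Dinf) small_resolution
  small_acyclic n.+1 t).
Qed.

Lemma from_small_diff n (c : tens M bool) :
  boundary (from_small n.+1 c) = from_small n (extend (@small_diff n.+1) c).
Proof.
rewrite boundaryE /from_small !extend_comp; apply: eq_extend => t.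
exact: (@comparison_map_chain _ small_resolution (bar_resolution Dinf)
  (@bar_acyclic Dinf) n.+1 t).
Qed.

Lemma to_small_cycle n (c : chain M n.+1) : boundary c = 0 ->
  extend (@small_diff n) (to_small c) = 0.
Proof.
rewrite boundaryE => c0.
have := extend_comp (@small_diff n)
  (@comparison_map Dinf (bar_resolution Dinf) small_resolution n.+1) c.
rewrite (eq_extend (@comparison_map_chain _ (bar_resolution Dinf)
  small_resolution small_acyclic n)).
by rewrite -(extend_comp (@comparison_map _ (bar_resolution Dinf)
  small_resolution n)) c0 extend0.
Qed.

Lemma from_small_cycle n (c : tens M bool) : extend (@small_diff n) c = 0 ->
  boundary (from_small n c) = 0.
Proof.
move=> c0; rewrite boundaryE.
have := extend_comp (@bar_diff Dinf n)
  (@comparison_map Dinf small_resolution (bar_resolution Dinf) n.+1) c.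
rewrite (eq_extend (@comparison_map_chain _ small_resolution
  (bar_resolution Dinf) (@bar_acyclic Dinf) n)).
by rewrite -(extend_comp (@comparison_map _ small_resolution
  (bar_resolution Dinf) n)) c0 extend0.
Qed.

Lemma to_smallK n (c : chain M n.+1) : boundary c = 0 ->
  exists w, boundary w = from_small n (to_small c) - c.
Proof.
rewrite boundaryE => c0.
have [w wE] := @comparison_inverse _ (bar_resolution Dinf) small_resolution
  (@bar_acyclic _) small_acyclic M n c c0.
by exists w; rewrite boundaryE.
Qed.

Lemma from_smallK n (c : tens M bool) : extend (@small_diff n) c = 0 ->
  exists w, extend (@small_diff n.+1) w = to_small (from_small n c) - c.
Proof.
exact: (@comparison_inverse _ small_resolution (bar_resolution Dinf)
  small_acyclic (@bar_acyclic _) M n c).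
Qed.

(** If [to_small c] bounds, so does its image in the bar complex, which differs
    from [c] by a boundary. *)
Lemma boundary_to_small n (c : chain M n.+1) : boundary c = 0 ->
  (exists w, boundary w = c) <-> (exists w, extend (@small_diff n.+1) w =
    to_small c).
Proof.
move=> c0; split=> [[w <-]|[w wE]].
  by exists (to_small w); rewrite to_small_diff.
have [v vE] := to_smallK c0; exists (from_small n.+1 w - v).
by rewrite boundaryB from_small_diff wE vE opprB addrC subrK.
Qed.

Lemma cycle_boundary0 n (z : cycle M n.+1) : boundary (cycle_val z) = 0.
Proof. exact/eqP/(valP z). Qed.

Lemma homology_even n (x : homology M n.+1) : odd_split M -> odd n -> x = 0.
Proof.
move=> sp on.
have [||f fi fE] := @homology_map _ M n.+1 M (fun=> 0).
- by move=> c d; rewrite subrr.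
- move=> z; split=> // _.
  apply/(boundary_to_small (cycle_boundary0 z)).
  exact: small_exact_even sp on (to_small_cycle (cycle_boundary0 z)).
by apply: fi; rewrite raddf0 -[x]reprK fE.
Qed.

(** Over the small complex, the cycles of odd degree are the families of
    invariants, and the boundaries are the families of elements [r v + v]; the
    map [theta] identifies the quotient of the former by the latter with [A].
    *)
Lemma homology_odd (A : zmodType) (theta : tens M bool -> A) n :
    odd_split M -> no_odd M -> ~~ odd n -> zmod_morphism theta ->
    (forall c, (forall b, gact (reflection b) c@_b = c@_b) ->
       theta c = 0 <-> forall b, exists v : M,
         c@_b = gact (reflection b) v + v) ->
    (forall a, exists2 c, (forall b, gact (reflection b) c@_b = c@_b) & theta c
      = a) ->
  zmod_iso (homology M n.+1) A.
Proof.
move=> sp nodd en thetaB theta0 theta_surj.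
have [||f fi fE] := @homology_map _ M n.+1 A (theta \o @to_small n).
- exact: (morph_comp (@to_small_morph n) thetaB).
- move=> z; rewrite (boundary_to_small (cycle_boundary0 z))
    small_boundary_odd //=.
  apply: theta0; apply: small_cycle_odd sp nodd en _.
  exact: to_small_cycle (cycle_boundary0 z).
exists f; apply: bijective_of_inj_surj => // a.
have [c cr <-] := theta_surj a.
have c0 : extend (@small_diff n) c = 0.
  case: n en {f fi fE} => [_|n /= en].
    by rewrite extend_small_diff0 !cr !subrr addr0 monalgU0.
  apply/malgP => b; rewrite mcoeff_small_diff cr -signr_odd (negbNE en) mulrN1z
    subrr.
  by rewrite mcoeff0.
have fc0 := from_small_cycle c0.
have cyc : from_small n c \in @is_cycle _ M n.+1 by apply/eqP.
exists (\pi_(homology M n.+1)%qT (Cycle cyc)); rewrite fE /=.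
have [w wE] := from_smallK c0.
apply/eqP; rewrite -subr_eq0 -thetaB -wE; apply/eqP.
apply/theta0; last by apply/(small_boundary_odd _ en); exists w.
apply: small_cycle_odd sp nodd en _.
exact: (differential_square (X := small_resolution)).
Qed.

End DihedralHomology.

(** * Continuous functions on an odometer *)

Section Levels.
Variables (G : groupType) (S : subgroup_chain G).
Local Notation X := (odometer S).
Local Notation at_level x i := (set_val x i).

Lemma odometer_proj (x : X) i : coset_proj (S i) (at_level x i.+1) = at_level x
  i.
Proof. exact: (set_mem (valP x)). Qed.

Lemma eq_level_le (x y : X) i j : (i <= j)%N ->
  at_level x j = at_level y j -> at_level x i = at_level y i.
Proof.
move=> /subnK <-; elim: (j - i)%N => // k IH; rewrite addSn => e.
by apply: IH; rewrite -(odometer_proj x) -(odometer_proj y) e.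
Qed.

(** The cylinders given by a finite level form a basis of neighbourhoods: the
    filter that they generate at [x] converges to [x] in every coordinate. *)
Lemma nbhs_level (x : X) (U : set X) : nbhs x U ->
  exists i, forall y : X, at_level y i = at_level x i -> U y.
Proof.
pose F : set_system X :=
  filter_from setT (fun i => [set y : X | at_level y i = at_level x i]).
have FF : Filter F.
  apply: filter_from_filter; first by exists 0%N.
  move=> i j _ _; exists (maxn i j) => // y /= e.
  by split; apply: eq_level_le e; rewrite ?leq_maxl ?leq_maxr.
suff Fx : F --> x by move=> /Fx [i _ iU]; exists i => y yi; exact: iU.
move=> A [B [[C Co <-] Cx] BA]; apply: filterS BA _.
suff : (set_val @ F) C by [].
have: (set_val : X -> _) @ F --> set_val x.
  apply/cvg_sup => i D [E [[E' E'o <-] E'x] ED].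
  exists i => // y /= yi; apply: ED => /=; rewrite /proj.
  by move: E'x; rewrite /= /proj -yi.
by apply; exact: open_nbhs_nbhs.
Qed.

(** The compactness argument, in the form of Koenig's lemma: if a function is
    not determined by any level, then, each level being finite, there is a
    nested sequence of cylinders on which it is not either; they converge to a
    point at which the function is not continuous. *)
Lemma cint_level (f : cint X) :
  exists i, forall x y : X, at_level x i = at_level y i -> f x = f y.
Proof.
apply: contrapT => nolevel.
pose bad i (a : coset_space (S i)) := forall j, exists x y : X,
  [/\ at_level x i = a, at_level y i = a, at_level x j = at_level y j & f x <>
    f y].
have uniform i (P : set (coset_space (S i))) :
    (forall a, P a -> ~ bad i a) ->
    exists j, forall x y : X, P (at_level x i) ->
      at_level x j = at_level y j -> f x = f y.
  move=> good.
  have ex a : exists j, P a -> forall x y : X, at_level x i = a ->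
      at_level y i = a -> at_level x j = at_level y j -> f x = f y.
    have [Pa|nPa] := pselect (P a); last by exists 0%N.
    apply: contrapT => nex; apply: (good a Pa) => j; apply: contrapT => nxy.
    apply: nex; exists j => _ x y xa ya xy; apply: contrapT => fxy.
    by apply: nxy; exists x, y.
  have [lev levP] := choice ex.
  have /finite_seqP[s sE] := @chain_finite _ S i.
  pose J := \max_(a <- s) lev a.
  exists (maxn i J) => x y Px xy.
  have xyi : at_level x i = at_level y i by apply: eq_level_le xy;
    exact: leq_maxl.
  apply: (levP _ Px) => //; apply: eq_level_le xy.
  apply: leq_trans (leq_maxr _ _); apply: leq_bigmax_seq => //.
  have : [set: coset_space (S i)] (at_level x i) by [].
  by rewrite sE.
have [a0 bad0] : exists a, bad 0%N a.
  apply: contrapT => nbad; apply: nolevel.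
  have [a _ ba|j jP] := @uniform 0%N setT; first by apply: nbad; exists a.
  by exists j => x y; exact: jP.
have badS i (a : coset_space (S i)) : bad i a ->
    exists a', coset_proj (S i) a' = a /\ bad i.+1 a'.
  move=> bada; apply: contrapT => nbad.
  have [a' pa' ba'|j jP] := @uniform i.+1 [set a' | coset_proj (S i) a' = a].
    by apply: nbad; exists a'.
  have [x [y [xa ya xy]]] := bada j; apply.
  by apply: jP xy; rewrite /= odometer_proj.
pose next i (u : {a : coset_space (S i) | bad i a}) :
    {a : coset_space (S i.+1) | bad i.+1 a} :=
  let w := cid (badS i (sval u) (svalP u)) in
  exist _ (sval w) (svalP w).2.
pose branch := nat_rect (fun i => {a : coset_space (S i) | bad i a})
  (exist _ a0 bad0) next.
have branchP : (fun i => sval (branch i)) \in @odometer_set _ S.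
  apply/mem_set => i /=.
  exact: (svalP (cid (badS i _ (svalP (branch i))))).1.
pose x : X := exist (fun y => y \in @odometer_set _ S) _ branchP.
have [|i iP] := @nbhs_level x (f @^-1` [set f x]).
  apply: (@cts_fun _ _ f x).
  exact: (@discrete_set1 (discrete_topology int)).
have [y [z [yi zi _]]] := svalP (branch i) 0%N; apply.
by rewrite (iP y) ?(iP z).
Qed.

End Levels.

(** * Periodic functions on the integers *)

Definition periodic (d : nat) (g : int -> int) : Prop :=
  forall l m, (d %| m - l)%Z -> g l = g m.

Section DihedralOdometer.
Variables (n : nat -> nat) (n_incr : {homo n : i j / (i < j)%N})
  (n_dvd : forall i, (n i %| n i.+1)%N).
Local Notation S := (dihedral_chain n_incr n_dvd).
Local Notation X := (odometer S).
Local Notation M := (odometer_cint S).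
Local Notation at_level x i := (set_val x i).
Implicit Types (f g : M) (x y : X).

(** The subgroup of level [i] contains the reflection [m |-> - m], so a coset
    of it is determined by a residue modulo [n i]. *)
Definition residue i (m : int) : coset_space (dihedral_sub n i) :=
  \pi_(coset_space (dihedral_sub n i))%qT (m, 0).

Lemma residue_eq i l m : residue i l = residue i m <-> (n i %| m - l)%Z.
Proof.
have -> : (n i %| m - l)%Z = ((((l, 0) : Dinf)^-1 * (m, 0))%g \in dihedral_sub
  n i).
  by rewrite dinf_subE /= expr0 !mulN1r mul1r addrC.
by split=> /coset_eqP.
Qed.

Lemma pi_residue i (h : Dinf) :
  \pi_(coset_space (dihedral_sub n i))%qT h = residue i h.1.
Proof.
case: h => m b; apply/coset_eqP.
by rewrite dinf_subE /= mulNr sign_Z2N addNr dvdz0.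
Qed.

Lemma residueP i (a : coset_space (dihedral_sub n i)) : exists m,
  a = residue i m.
Proof. by exists (repr a).1; rewrite -pi_residue reprK. Qed.

Lemma n_dvd_le i j : (i <= j)%N -> (n i %| n j)%N.
Proof.
move=> /subnK <-; elim: (j - i)%N => // k IH; rewrite addSn.
exact: dvdn_trans IH (n_dvd _).
Qed.

Lemma n_gt0 i : (0 < n i)%N.
Proof. exact: dihedral_index_gt0 n_incr n_dvd i. Qed.

(** A sequence of integers that is compatible with the projections between
    consecutive levels, and so defines a point of the odometer. *)
Definition coherent (c : nat -> int) := forall i, (n i %| c i.+1 - c i)%Z.

Lemma coset_proj_residue i m :
  coset_proj (dihedral_sub n i) (residue i.+1 m) = residue i m.
Proof. exact/coset_projE/dihedral_subset. Qed.

Lemma point_subproof (c : nat -> int) : coherent c ->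
  (fun i => residue i (c i)) \in @odometer_set _ S.
Proof.
move=> cc; apply/mem_set => i /=; rewrite coset_proj_residue.
by apply/esym/residue_eq.
Qed.

Definition point (c : nat -> int) (cc : coherent c) : X :=
  exist (fun z => z \in @odometer_set _ S) _ (point_subproof cc).

Lemma coherent_cst m : coherent (fun=> m).
Proof. by move=> i; rewrite subrr dvdz0. Qed.

(** The integers embed in the odometer as an orbit of the translations, which
    is dense. *)
Definition on_integers f (m : int) : int := f (point (coherent_cst m)).

Definition level_determined f i := forall x y,
  at_level x i = at_level y i -> f x = f y.

Lemma level_determinedP f : exists i, level_determined f i.
Proof. exact: cint_level. Qed.

Lemma level_determined_le f i j : (i <= j)%N -> level_determined f i ->
  level_determined f j.
Proof. by move=> ij fi x y xy; apply/fi/(eq_level_le ij). Qed.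

Lemma level_determined_periodic f i : level_determined f i -> periodic (n i)
  (on_integers f).
Proof. by move=> fi l m lm; apply/fi/residue_eq. Qed.

Lemma eval_point f i c (cc : coherent c) : level_determined f i ->
  f (point cc) = on_integers f (c i).
Proof. by move=> fi; apply: fi. Qed.

Lemma on_integers_inj f g : on_integers f =1 on_integers g -> f = g.
Proof.
move=> fg; apply/continuousEP => x.
have [i fi] := level_determinedP f; have [j gj] := level_determinedP g.
have [m xm] := residueP (at_level x (maxn i j)).
have -> : f x = on_integers f m by apply:
  (level_determined_le (leq_maxl i j) fi).
by rewrite fg; apply: (level_determined_le (leq_maxr i j) gj).
Qed.

Lemma evalB f g x : (f - g) x = f x - g x.
Proof. by []. Qed.

Lemma on_integersB f g m : on_integers (f - g) m = on_integers f m -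
  on_integers g m.
Proof. by []. Qed.

Lemma on_integersD f g m : on_integers (f + g) m = on_integers f m +
  on_integers g m.
Proof. by []. Qed.

Lemma on_integers_act (h : Dinf) f m :
  on_integers (gact h^-1%g f) m = on_integers f (h.1 + (-1) ^+ (h.2 : nat) * m).
Proof.
have [i fi] := level_determinedP f; apply: (fi) => /=.
by rewrite invgK [LHS]coset_actE pi_residue.
Qed.

Lemma on_integers_refl b f m : on_integers (gact (reflection b) f) m =
  on_integers f ((b : nat)%:Z - m).
Proof. by rewrite -[reflection b]reflectionV on_integers_act expr1 mulN1r. Qed.

Section Realize.
Variables (i : nat) (g : int -> int).
Hypothesis gP : periodic (n i) g.

Lemma realize_continuous :
  continuous (fun x : X => g (repr (at_level x i)).1 : discrete_topology int).
Proof.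
move=> x; apply: (@continuous_comp _ _ _
  (fun y : X => at_level y i : discrete_topology (coset_space (S i)))
  (fun a => g (repr a).1 : discrete_topology int)).
  apply: (@continuous_comp _ _ _ (set_val : X -> _) (@proj _ _ i)).
    exact: initial_continuous.
  exact: proj_continuous.
exact: continuous_from_discrete.
Qed.

Definition realize : M := mkcts realize_continuous.

Lemma on_integers_realize : on_integers realize =1 g.
Proof.
move=> m; rewrite /on_integers /= /mkcts /=; apply: gP.
by apply/residue_eq; rewrite -pi_residue reprK.
Qed.

End Realize.

End DihedralOdometer.

Arguments realize {n} n_incr n_dvd i g.

(** * Splitting and summing periodic functions *)

Lemma periodic_modz d g m : periodic d g -> g (m %% d)%Z = g m.
Proof. by apply; rewrite {1}(divz_eq m d) addrK dvdz_mull. Qed.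

Lemma modz_reflect (d : nat) (b l m : int) : (d %| m - l)%Z ->
  ((b - l) %% d)%Z = ((b - m) %% d)%Z.
Proof.
move=> lm; apply/eqP; rewrite eqz_mod_dvd.
by have -> : b - l - (b - m) = m - l by ring.
Qed.

Lemma modz_eq (d : nat) (l m : int) : (d %| m - l)%Z -> (l %% d)%Z = (m %% d)%Z.
Proof. by rewrite -eqz_mod_dvd => /eqP. Qed.

(** On a pair of residues exchanged by the reflection, [g] is the opposite of
    [F] at the smaller one and zero at the larger one; at a fixed residue [F]
    vanishes, being equal to its opposite. *)
Lemma odd_split_periodic (b : int) d (F : int -> int) : periodic d F ->
  (forall m, F (b - m) = - F m) ->
  exists2 g, periodic d g & forall m, F m = g (b - m) - g m.
Proof.
move=> Fp FN; exists (fun m => if ((m %% d)%Z < ((b - m) %% d)%Z)%R then - F m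
  else 0).
  by move=> l m lm; rewrite (modz_eq lm) (modz_reflect b lm) (Fp _ _ lm).
move=> m; rewrite opprB addrCA subrr addr0.
case: ltgtP => e; rewrite ?FN ?opprK ?subr0 ?add0r //.
have : F m = - F m by rewrite -FN -(periodic_modz m Fp) -e periodic_modz.
by lia.
Qed.

(** On a pair of residues exchanged by the reflection, [g] is equal to [F] at
    the smaller one and zero at the larger one; at a fixed residue it must be
    half of [F]. *)
Lemma even_split_periodic (b : int) d (F : int -> int) : periodic d F ->
  (forall m, F (b - m) = F m) ->
  (forall m, (d %| m *+ 2 - b)%Z -> (2 %| F m)%Z) ->
  exists2 g, periodic d g & forall m, F m = g (b - m) + g m.
Proof.
move=> Fp FE F2.
exists (fun m => if ((m %% d)%Z < ((b - m) %% d)%Z)%R then F m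
  else if (m %% d)%Z == ((b - m) %% d)%Z then (F m %/ 2)%Z else 0).
  by move=> l m lm; rewrite (modz_eq lm) (modz_reflect b lm) (Fp _ _ lm).
move=> m; rewrite opprB addrCA subrr addr0 [_ == (m %% d)%Z]eq_sym.
case: ltgtP => e; rewrite ?FE ?addr0 ?add0r //.
have /F2 : (d %| m *+ 2 - b)%Z.
  have -> : m *+ 2 - b = m - (b - m) by ring.
  by rewrite -eqz_mod_dvd e.
by move/divzK => {1}<-; ring.
Qed.

Definition psum (d : nat) (g : int -> int) : int := \sum_(k < d) g (k : nat)%:Z.

Lemma psumM q d g : periodic d g -> psum (q * d) g = psum d g *+ q.
Proof.
move=> gp; elim: q => [|q IH]; first by rewrite /psum big_ord0.
rewrite mulSn mulrS -IH /psum big_split_ord /=; congr (_ + _).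
by apply: eq_bigr => k _; apply: gp; rewrite PoszD opprD addrCA subrr addr0
  rpredN.
Qed.

(** The maps [m |-> c + m] and [m |-> c - m] permute the residues. *)
Lemma psum_affine d g (c : int) (a : bool) : (0 < d)%N -> periodic d g ->
  psum d (fun m => g (c + (-1) ^+ a * m)) = psum d g.
Proof.
move=> d0 gp; have dz0 : (d : int) != 0 by lia.
have lt (k : int) : (`|(k %% d)%Z| < d)%N.
  by have := modz_ge0 k dz0; have := ltz_pmod k (ltac:(lia) : (0 < d%:Z)%R);
    lia.
pose h (k : 'I_d) : 'I_d := Ordinal (lt (c + (-1) ^+ a * (k : nat)%:Z)).
have hE k : (h k : nat)%:Z = ((c + (-1) ^+ a * (k : nat)%:Z) %% d)%Z.
  by rewrite /= gez0_abs ?modz_ge0.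
have hI : injective h.
  move=> k l /(congr1 (fun i : 'I_d => (i : nat)%:Z)); rewrite !hE => /eqP.
  rewrite eqz_mod_dvd opprD addrACA subrr add0r -mulrBr => dvd.
  have : (d %| (k : nat)%:Z - (l : nat)%:Z)%Z.
    by case: a dvd {h hE} => /=; rewrite ?expr1 ?mulN1r ?rpredN ?expr0 ?mul1r.
  rewrite -eqz_mod_dvd !modz_small ?ltz_nat ?ltn_ord //; last first.
  by move=> /eqP[] /val_inj.
rewrite /psum [RHS](reindex_inj hI); apply: eq_bigr => k _.
by rewrite hE periodic_modz.
Qed.

(** The partial sums of [F] over a period are well defined on residues because
    the sum over the whole period is zero. *)
Lemma psum_primitive d F : (0 < d)%N -> periodic d F -> psum d F = 0 ->
  exists2 g, periodic d g & forall m, F m = g (m + 1) - g m.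
Proof.
move=> d0 Fp F0; have dz0 : (d : int) != 0 by lia.
exists (fun m => psum `|(m %% d)%Z| F); first by move=> l m /modz_eq ->.
move=> m.
have r0 := modz_ge0 m dz0.
have rd := ltz_pmod m (ltac:(lia) : (0 < d%:Z)%R).
have : F (m %% d)%Z = F m := periodic_modz m Fp.
have mS : ((m + 1) %% d)%Z = (((m %% d)%Z + 1) %% d)%Z by rewrite modzDml.
move: r0 rd mS; case: (m %% d)%Z => // r _ rd mS FE.
have Sr : psum r.+1 F = psum r F + F r by rewrite /psum big_ord_recr.
have [rd'|rd'] := ltnP r.+1 d.
  have -> : ((m + 1) %% d)%Z = r.+1%:Z.
    by rewrite mS modz_small; lia.
  by rewrite /= Sr -FE addrAC subrr add0r.
have rE : r.+1 = d by lia.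
have -> : ((m + 1) %% d)%Z = 0.
  by rewrite mS -[r%:Z + 1]/(Posz (r + 1)) addn1 rE modzz.
by rewrite -FE /= {1}/psum big_ord0 sub0r; move: Sr; rewrite rE F0; lia.
Qed.

(** * The module of the dihedral odometer *)

Section OdometerHomology.
Variables (n : nat -> nat) (n_incr : {homo n : i j / (i < j)%N})
  (n_dvd : forall i, (n i %| n i.+1)%N).
Local Notation S := (dihedral_chain n_incr n_dvd).
Local Notation M := (odometer_cint S).
Implicit Types f g : M.

Let n0 i : (0 < n i)%N. Proof. exact: n_gt0 n_incr n_dvd i. Qed.

Lemma odometer_odd_split : odd_split M.
Proof.
move=> b f fN; have [i fi] := level_determinedP f.
have [g gp gE] := @odd_split_periodic (b : nat)%:Z _ _
  (level_determined_periodic fi)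
  (fun m => etrans (esym (on_integers_refl b f m))
    (congr1 (fun h : M => on_integers h m) fN)).
exists (realize n_incr n_dvd i g); apply: on_integers_inj => m.
by rewrite on_integersB on_integers_refl !(on_integers_realize _ _ gp).
Qed.

(** Such a function is invariant under the translation [m |-> m + 1], the
    product of the two reflections, hence constant and equal to its opposite.
    *)
Lemma odometer_no_odd : no_odd M.
Proof.
move=> f fN; have fNm (b : bool) m : on_integers f ((b : nat)%:Z - m) = -
  on_integers f m.
  by rewrite -on_integers_refl fN.
have f1 m : on_integers f (m + 1) = on_integers f m.
  have -> : m + 1 = (true : nat)%:Z - ((false : nat)%:Z - m) by rewrite /=;
    ring.
  by rewrite !fNm opprK.
have f0 m : on_integers f m = on_integers f 0.
  elim/int_rec: m => // k IH; last rewrite -f1.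
    have -> : k.+1%:Z = k%:Z + 1 by lia.
    by rewrite f1 IH.
  have -> : - k.+1%:Z + 1 = - k%:Z by lia.
  by rewrite IH.
apply: on_integers_inj => m; rewrite f0.
have := fNm false 0; rewrite /= subr0 => e.
suff -> : on_integers f 0 = 0 by [].
by move: (on_integers f 0) e => k; lia.
Qed.

Lemma odometer_even_split b f i : level_determined f i -> gact (reflection b) f
  = f ->
  (forall m, (n i %| m *+ 2 - (b : nat)%:Z)%Z -> (2 %| on_integers f m)%Z) ->
  exists g, f = gact (reflection b) g + g.
Proof.
move=> fi fE f2.
have [g gp gE] := @even_split_periodic (b : nat)%:Z _ _
  (level_determined_periodic fi)
  (fun m => etrans (esym (on_integers_refl b f m))
    (congr1 (fun h : M => on_integers h m) fE)) f2.
exists (realize n_incr n_dvd i g); apply: on_integers_inj => m.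
by rewrite on_integersD on_integers_refl !(on_integers_realize _ _ gp).
Qed.

(** * Degree zero: averages *)

Lemma psum_level_determined f i j : level_determined f i -> level_determined f
  j ->
  (psum (n i) (on_integers f))%:~R / (n i)%:R =
  (psum (n j) (on_integers f))%:~R / (n j)%:R :> rat.
Proof.
wlog ij : i j / (i <= j)%N => [H fi fj|fi _].
  by have [/H|/ltnW/H] := leqP i j; [apply|move=> ->].
have /dvdnP[q qE] := n_dvd_le n_dvd ij.
have ni0 : (n i)%:R != 0 :> rat by rewrite pnatr_eq0 -lt0n.
have q0 : q%:R != 0 :> rat.
  by rewrite pnatr_eq0 -lt0n; have := n0 j; rewrite qE muln_gt0 => /andP[].
rewrite qE (psumM _ (level_determined_periodic fi)) natrM rmorphMn /=
  -[_ *+ q]mulr_natr.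
by field; rewrite ni0 q0.
Qed.

(** The integral of a function against the invariant probability measure on the
    odometer. *)
Definition mean f : rat :=
  let i := sval (cid (level_determinedP f)) in (psum (n i) (on_integers f))%:~R
    / (n i)%:R.

Lemma meanE f i : level_determined f i ->
  mean f = (psum (n i) (on_integers f))%:~R / (n i)%:R.
Proof. by apply: psum_level_determined; exact: svalP
  (cid (level_determinedP f)). Qed.

Lemma mean_morph : zmod_morphism mean.
Proof.
move=> f g; have [i fi] := level_determinedP f;
  have [j gj] := level_determinedP g.
have {}fi := level_determined_le (leq_maxl i j) fi;
  have {}gj := level_determined_le (leq_maxr i j) gj.
have fg : level_determined (f - g) (maxn i j) by move=> x y xy;
  rewrite !evalB (fi x y xy) (gj x y xy).
rewrite (meanE fi) (meanE gj) (meanE fg) -mulrBl -rmorphB /=; congr (_%:~R / _).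
by rewrite /psum -sumrB.
Qed.

Lemma mean_act h f : mean (gact h f) = mean f.
Proof.
have [i fi] := level_determinedP f.
have hi : level_determined (gact h f) i by move=> x y xy; apply: fi;
  exact: (congr1 (coset_act h^-1%g) xy).
rewrite (meanE fi) (meanE hi); congr (_%:~R / _).
rewrite -(psum_affine (h^-1%g).1 ((h^-1%g).2 == 1) (n0 i)
  (level_determined_periodic fi)).
apply: eq_bigr => k _; rewrite -{1}[h]invgK on_integers_act.
by congr (on_integers f (_ + _ * _)); case: (Z2_cases (h^-1%g).2) => ->.
Qed.

Lemma mean_eq0 f : mean f = 0 -> exists h g, f = gact h g - g.
Proof.
have [i fi] := level_determinedP f; rewrite (meanE fi) => /eqP.
rewrite mulf_eq0 invr_eq0 pnatr_eq0 -[_ == 0%N]negbK -lt0n n0 orbF intr_eq0 =>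
  /eqP s0.
have [g gp gE] := psum_primitive (n0 i) (level_determined_periodic fi) s0.
(* Translation by one. *)
exists (((1%:Z, 0) : Dinf)^-1)%g, (realize n_incr n_dvd i g);
  apply: on_integers_inj => m.
by rewrite on_integersB on_integers_act !(on_integers_realize _ _ gp) gE /=
  expr0 mul1r [1 + m]addrC.
Qed.

Lemma mean_surj (m : int) i : exists f, mean f = m%:~R / (n i)%:R.
Proof.
pose g (l : int) : int := if (n i %| l)%Z then m else 0.
have gp : periodic (n i) g.
  by move=> k l kl; rewrite /g -[l](subrK k) rpredDl.
exists (realize n_incr n_dvd i g).
have ri : level_determined (realize n_incr n_dvd i g) i by move=> x y xy;
  rewrite /= /mkcts /= xy.
rewrite (meanE ri); congr (_%:~R / _).
have -> : psum (n i) (on_integers (realize n_incr n_dvd i g)) = psum (n i) g.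
  by apply: eq_bigr => k _; rewrite (on_integers_realize _ _ gp).
rewrite /psum (bigD1 (Ordinal (n0 i))) //= big1 ?addr0 => [|k k0].
  by rewrite /g dvdz0.
rewrite /g dvdzE /= gtnNdvd ?ltn_ord // lt0n.
by apply: contraNneq k0 => k0; apply/eqP/val_inj.
Qed.

Theorem homology0_mean :
  exists2 f : {additive homology M 0%N -> rat}, injective f &
    range f = [set q : rat | exists (m : int) (i : nat), q = m%:~R / (n i)%:R].
Proof.
pose t0 : {ffun 'I_0 -> Dinf} := [ffun=> 1%g].
have t0E (t : {ffun 'I_0 -> Dinf}) : t = t0 by apply/ffunP => -[].
have chain0E (c : chain M 0) : c = << c@_t0 *g t0 >>.
  by apply/malgP => t; rewrite (t0E t) mcoeffUU.
pose g (c : chain M 0) := mean c@_t0.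
have gB : zmod_morphism g by move=> c d; rewrite /g mcoeffB mean_morph.
have dE (t : {ffun 'I_1 -> Dinf}) (f : M) :
    boundary (<< f *g t >> : chain M 1) = << gact (t ord0)^-1%g f - f *g t0 >>.
  rewrite boundaryU !big_ord_recl big_ord0 addr0 expr0 expr1 mulrN1z mulr1z.
  by rewrite /face_coef /= !(t0E (face _ _)) monalgUB.
have [|f fi fE] := @homology_map _ M 0 rat g gB.
  move=> z; split=> [/mean_eq0[h [f fE]]|[c <-]].
    exists << f *g [ffun=> h^-1%g] >>.
    by rewrite dE ffunE invgK -fE -chain0E.
  move: c; apply: (@malg_morph_ext _ _ _ (g \o @boundary _ M 0) (fun=> 0)) =>
    [||t u].
  - exact: (morph_comp (@boundaryB _ M 0) gB).
  - by move=> c d; rewrite subrr.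
  by rewrite /= dE /g mcoeffUU mean_morph mean_act subrr.
exists f => //; apply/seteqP; split=> [_ [x _ <-]|_ [m [i ->]]] /=.
  rewrite -[x]reprK fE /g /mean; set i := sval _.
  by exists (psum (n i) (on_integers (cycle_val (repr x))@_t0)), i.
have [u uE] := mean_surj m i.
have cyc : << u *g t0 >> \in @is_cycle _ M 0 by [].
by exists (\pi_(homology M 0)%qT (Cycle cyc)) => //; rewrite fE /g mcoeffUU.
Qed.

End OdometerHomology.

(** * Odd degrees: parities at fixed points *)

Section Parity.

Definition parity (z : int) : 'Z_2 := z%:~R.

Lemma parity_eq0 z : (parity z == 0) = (2 %| z)%Z.
Proof.
have p2 q : parity (q * 2) = 0.
  by rewrite /parity rmorphM /= [2%:~R](_ : _ = 0) ?mulr0 //; exact/val_inj.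
apply/idP/idP => [|/dvdzP[q ->]]; last by rewrite p2.
rewrite {1}(divz_eq z 2) [parity _]rmorphD /= -/(parity _) p2 add0r dvdzE.
have := modz_ge0 z (isT : 2 != 0 :> int); have := ltz_pmod z
  (isT : (0 < 2%:Z)%R).
move=> lt ge; have [e|e] : (z %% 2)%Z = 0 \/ (z %% 2)%Z = 1 by lia.
  by move=> _; apply/dvdz_mod0P.
by rewrite e.
Qed.

Lemma parity_nat (a : 'Z_2) : parity (a : nat)%:Z = a.
Proof. by case: (Z2_cases a) => ->; exact/val_inj. Qed.

Lemma parityB (x y : int) : parity (x - y) = parity x - parity y.
Proof. exact: rmorphB. Qed.

End Parity.

Section OddHomology.
Variables (n : nat -> nat) (n_incr : {homo n : i j / (i < j)%N})
  (n_dvd : forall i, (n i %| n i.+1)%N).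
Local Notation S := (dihedral_chain n_incr n_dvd).
Local Notation M := (odometer_cint S).
Local Notation zero_point := (point n_incr n_dvd (coherent_cst n 0)).
Implicit Types f g : M.

(** The point given by [c] is fixed by the reflection, so [r g] and [g] take
    the same value there. *)
Lemma parity_norm (b : bool) g c (cc : coherent n c) i0 :
  (forall j, (i0 <= j)%N -> (n j %| c j *+ 2 - (b : nat)%:Z)%Z) ->
  parity ((gact (reflection b) g + g) (point n_incr n_dvd cc)) = 0.
Proof.
move=> fixed; apply/eqP; rewrite parity_eq0.
have [i gi] := level_determinedP g; have [j hj] := level_determinedP
  (gact (reflection b) g).
pose k := maxn i0 (maxn i j).
have {}gi : level_determined g k by apply: level_determined_le gi; rewrite /k;
  lia.
have {}hj : level_determined (gact (reflection b) g) k by apply: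
  level_determined_le hj; rewrite /k; lia.
have -> : (gact (reflection b) g + g) (point n_incr n_dvd cc) =
  on_integers (gact (reflection b) g) (c k) + on_integers g (c k).
  by rewrite -(eval_point cc hj) -(eval_point cc gi).
rewrite on_integers_refl.
have -> : on_integers g ((b : nat)%:Z - c k) = on_integers g (c k).
  apply: (level_determined_periodic gi).
  have -> : c k - ((b : nat)%:Z - c k) = c k *+ 2 - (b : nat)%:Z by ring.
  by apply: fixed; rewrite /k; lia.
by apply/dvdzP; exists (on_integers g (c k)); ring.
Qed.

Definition const_fun (z : int) : M := realize n_incr n_dvd 0 (fun=> z).

Lemma const_fun_inv b z : gact (reflection b) (const_fun z) = const_fun z.
Proof. by apply/continuousEP. Qed.

(** Passing to a level where the quotient of periods is even, every residue
    fixed by [m |-> - m] lies above the residue [0] of the level before, and no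
    residue is fixed by [m |-> 1 - m] since the period is even. *)
Lemma homology_odd_one_center k : (forall i, exists2 j,
  (i <= j)%N & ~~ odd (n j.+1 %/ n j)) ->
  ~~ odd k -> zmod_iso (homology M k.+1) 'Z_2.
Proof.
move=> ev ek.
pose theta (c : tens M bool) : 'Z_2 := parity (c@_false zero_point).
apply: (homology_odd (theta := theta)) => //.
- exact: odometer_odd_split.
- exact: odometer_no_odd.
- by move=> c d; rewrite /theta mcoeffB evalB parityB.
- move=> c ci; split=> [/eqP|sp]; last first.
    have [g gE] := sp false; rewrite /theta gE.
    by apply: (@parity_norm _ _ _ _ 0%N) => j _; rewrite /= mul0rn subrr dvdz0.
  rewrite /theta parity_eq0 => c2 b.
  have [i fi] := level_determinedP c@_b; have [i' fi'] := level_determinedP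
    c@_false.
  have [j ij oj] := ev (maxn i i').
  have fj : level_determined c@_b j.+1 by apply: level_determined_le fi; lia.
  have fj' : level_determined c@_false j by apply: level_determined_le fi'; lia.
  apply: (odometer_even_split fj (ci b)) => m.
  have /dvdnP[q nE] := n_dvd j.
  have nj0 := n_gt0 n_incr n_dvd j.
  have [r qE] : exists r, q = r.*2.
    by exists q./2; rewrite -[LHS]odd_double_half; move: oj;
      rewrite nE mulnK // => /negbTE ->.
  have {}nE : (n j.+1)%:Z = (n j)%:Z * r%:Z * 2 by rewrite nE qE; lia.
  rewrite nE; case: b {fj fi} => /=.
    by move=> /dvdzP[l lE]; lia.
  move=> /dvdzP[l lE].
  (* A solution of [2 m = 0] modulo [n j.+1] is a multiple of [n j], because
     the quotient of the two periods is even. *)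
  have mE : m = l * r%:Z * (n j)%:Z by lia.
  have -> : on_integers c@_false m = on_integers c@_false 0.
    by apply: (level_determined_periodic fj');
      rewrite sub0r rpredN mE dvdz_mull.
  exact: c2.
move=> a; exists << const_fun (a : nat)%:Z *g false >>.
  by case; rewrite mcoeffU /= ?const_fun_inv ?mulr0n ?(morph0 (@gactB _ _ _)).
by rewrite /theta mcoeffUU; exact: parity_nat.
Qed.

(** The hypotheses say that the points given by [c1] and [c2] are fixed by the
    reflections indexed by [b1] and [b2], that at high levels these give all
    the fixed residues, and that the parities at the two points are
    independent. *)
Lemma homology_odd_two_centers k (b1 b2 : bool) c1 c2 (cc1 : coherent n c1)
  (cc2 : coherent n c2) i0 :
  ~~ odd k ->
  (forall j, (i0 <= j)%N -> (n j %| c1 j *+ 2 - (b1 : nat)%:Z)%Z) ->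
  (forall j, (i0 <= j)%N -> (n j %| c2 j *+ 2 - (b2 : nat)%:Z)%Z) ->
  (forall j (b : bool) m, (i0 <= j)%N -> (n j %| m *+ 2 - (b : nat)%:Z)%Z ->
     (b = b1 /\ (n j %| m - c1 j)%Z) \/ (b = b2 /\ (n j %| m - c2 j)%Z)) ->
  (forall a1 a2 : 'Z_2, exists c : tens M bool,
     [/\ forall b, gact (reflection b) c@_b = c@_b,
         parity (c@_b1 (point n_incr n_dvd cc1)) = a1 &
         parity (c@_b2 (point n_incr n_dvd cc2)) = a2]) ->
  zmod_iso (homology M k.+1) ('Z_2 * 'Z_2)%type.
Proof.
move=> ek fixed1 fixed2 cover surj.
pose theta (c : tens M bool) : ('Z_2 * 'Z_2)%type :=
  (parity (c@_b1 (point n_incr n_dvd cc1)), parity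
    (c@_b2 (point n_incr n_dvd cc2))).
apply: (homology_odd (theta := theta)) => //.
- exact: odometer_odd_split.
- exact: odometer_no_odd.
- by move=> c d; rewrite /theta !mcoeffB !evalB !parityB.
- move=> c ci; split=> [[/eqP + /eqP]|sp]; last first.
    have [g1 g1E] := sp b1; have [g2 g2E] := sp b2; rewrite /theta g1E g2E.
    by congr pair; apply: (@parity_norm _ _ _ _ i0).
  rewrite !parity_eq0 => p1 p2 b.
  have [i fi] := level_determinedP c@_b.
  have {}fi : level_determined c@_b (maxn i0 i) by apply: level_determined_le
    fi; lia.
  apply: (odometer_even_split fi (ci b)) => m.
  move=> /(cover _ _ _ (leq_maxl i0 i)) [[e]|[e]] mc; rewrite e in fi *.
    by rewrite -(level_determined_periodic fi mc) -(eval_point cc1 fi).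
  by rewrite -(level_determined_periodic fi mc) -(eval_point cc2 fi).
by move=> [a1 a2]; have [c [ci <- <-]] := surj a1 a2; exists c.
Qed.

End OddHomology.

Lemma odd_dvdz_mul2 (d : nat) (m : int) : odd d -> (d %| m *+ 2)%Z ->
  (d %| m)%Z.
Proof.
move=> od; rewrite !dvdzE /= -mulr_natr abszM Gauss_dvdl //.
by rewrite coprime_sym coprime2n.
Qed.

Section Cases.
Variables (n : nat -> nat) (n_incr : {homo n : i j / (i < j)%N})
  (n_dvd : forall i, (n i %| n i.+1)%N).
Local Notation S := (dihedral_chain n_incr n_dvd).
Local Notation M := (odometer_cint S).

(** Modulo an odd number [d], the only solution of [2 x = 1] is [(d + 1) / 2];
    by uniqueness the solutions at consecutive levels are compatible. *)
Lemma odd_center_coherent :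
  (forall j, odd (n j)) -> coherent n (fun j => (uphalf (n j))%:Z).
Proof.
move=> on j; apply: odd_dvdz_mul2 (on j) _.
have [oj oj'] := (on j, on j.+1).
have -> : ((uphalf (n j.+1))%:Z - (uphalf (n j))%:Z) *+ 2 = (n j.+1)%:Z -
  (n j)%:Z by lia.
by rewrite rpredB // dvdzE /= ?dvdnn.
Qed.

Lemma homology_odd_period k : (forall j, odd (n j)) -> ~~ odd k ->
  zmod_iso (homology M k.+1) ('Z_2 * 'Z_2)%type.
Proof.
move=> on ek.
apply: (@homology_odd_two_centers n n_incr n_dvd k false true _ _
  (coherent_cst n 0)
  (odd_center_coherent on) 0%N ek).
- by move=> j _; rewrite /= mul0rn subrr dvdz0.
- move=> j _; have oj := on j.
  by have -> : (uphalf (n j))%:Z *+ 2 - (true : nat)%:Z = (n j)%:Z by rewrite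
    /=; lia.
- move=> j [] m _ /= dm; [right|left]; split=> //.
    apply: odd_dvdz_mul2 (on j) _; have oj := on j.
    have -> : (m - (uphalf (n j))%:Z) *+ 2 = m *+ 2 - 1 - (n j)%:Z by lia.
    by rewrite rpredB.
  by rewrite subr0; apply: odd_dvdz_mul2 (on j) _; rewrite subr0 in dm.
move=> a1 a2.
pose f (a : 'Z_2) := const_fun n_incr n_dvd (a : nat)%:Z.
exists (<< f a1 *g false >> + << f a2 *g true >>); split.
- by move=> [|]; rewrite mcoeffD !mcoeffU /= ?addr0 ?add0r const_fun_inv.
- by rewrite mcoeffD mcoeffUU mcoeffU mulr0n addr0 parity_nat.
by rewrite mcoeffD mcoeffUU mcoeffU mulr0n add0r parity_nat.
Qed.

Section EvenPeriod.
Variable i0 : nat.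
Hypotheses (even0 : ~~ odd (n i0))
  (oddq : forall j, (i0 <= j)%N -> odd (n j.+1 %/ n j)).

Lemma even_period j : (i0 <= j)%N -> ~~ odd (n j).
Proof.
move=> ij; have /dvdnP[q ->] := n_dvd_le n_dvd ij.
by rewrite oddM (negbTE even0) andbF.
Qed.

(** If the period is even and is multiplied by an odd number, half of the new
    period is congruent to half of the old one modulo the old period. *)
Lemma half_period_coherent : coherent n (fun j => ((n (maxn i0 j))./2)%:Z).
Proof.
move=> j; cbv beta; have [ji|ij] := ltnP j i0.
  by rewrite (maxn_idPl ji) subrr dvdz0.
rewrite (maxn_idPr (leqW ij)).
have oq := oddq ij; have ej := even_period ij.
have /dvdnP[q nE] := n_dvd j.
have {}oq : odd q by move: oq; rewrite nE mulnK // n_gt0.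
have [r qE] : exists r, q = r.*2.+1 by exists q./2; lia.
apply/dvdzP; exists r%:Z; rewrite nE qE.
by move: ej; move: (n j) => d ed; nia.
Qed.

Lemma homology_even_period k : ~~ odd k ->
  zmod_iso (homology M k.+1) ('Z_2 * 'Z_2)%type.
Proof.
move=> ek.
apply: (@homology_odd_two_centers n n_incr n_dvd k false false _ _
  (coherent_cst n 0)
  half_period_coherent i0 ek).
- by move=> j _; rewrite /= mul0rn subrr dvdz0.
- move=> j ij; have ej := even_period ij; rewrite (maxn_idPr ij) subr0.
  by have -> : ((n j)./2)%:Z *+ 2 = (n j)%:Z by lia.
- move=> j b m ij /dvdzP[l lE]; have ej := even_period ij;
    rewrite (maxn_idPr ij) subr0.
  have [h hE] : exists h, n j = h.*2 by exists (n j)./2; lia.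
  rewrite hE in lE *; case: b lE => /= lE; first by nia.
  have mE : m = l * h%:Z by lia.
  have [q [qE|qE]] : exists q, l = q * 2 \/ l = q * 2 + 1.
    exists (l %/ 2)%Z; have := divz_eq l 2.
    have := modz_ge0 l (isT : 2 != 0 :> int); have := ltz_pmod l
      (isT : (0 < 2%:Z)%R).
    by lia.
    by left; split=> //; apply/dvdzP; exists q; rewrite mE qE; lia.
  by right; split=> //; apply/dvdzP; exists q; rewrite mE qE doubleK; lia.
move=> a1 a2.
(* Half of the period is not a multiple of [n i0], so the values at the two
   fixed points can be prescribed independently. *)
pose F (m : int) : int := if (n i0 %| m)%Z then (a1 : nat)%:Z else
  (a2 : nat)%:Z.
have Fp : periodic (n i0) F.
  by move=> l m lm; rewrite /F -[m](subrK l) rpredDl.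
pose f : M := realize n_incr n_dvd i0 F.
have fi : level_determined f i0 by move=> x y xy; rewrite /= /mkcts /= xy.
exists << f *g false >>; split.
- case; rewrite mcoeffU /= ?mulr0n ?(morph0 (@gactB _ _ _)) //.
  apply: on_integers_inj => m.
  by rewrite on_integers_refl !(on_integers_realize _ _ Fp) /F sub0r rpredN.
- by rewrite mcoeffUU (eval_point _ fi) (on_integers_realize _ _ Fp) /F dvdz0
    parity_nat.
rewrite mcoeffUU (eval_point _ fi) (on_integers_realize _ _ Fp) /F maxnn dvdzE
  /=.
have n0 := n_gt0 n_incr n_dvd i0.
by rewrite gtnNdvd ?parity_nat //; move: even0 n0; lia.
Qed.

End EvenPeriod.

End Cases.

Theorem theorem3p5 (n : nat -> nat)
  (n_incr : {homo n : i j / (i < j)%N})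
  (n_dvd : forall i, (n i %| n i.+1)%N) :
  let H := homology (odometer_cint (dihedral_chain n_incr n_dvd)) in
  [/\ exists2 f : {additive H 0%N -> rat}, injective f &
        range f = [set q : rat | exists (m : int) (i : nat),
                                   q = m%:~R / (n i)%:R],
      forall k : nat, (1 <= k)%N -> forall x : H (2 * k)%N, x = 0 &
      forall k : nat, (1 <= k)%N ->
        (infinite_set [set i : nat | ~~ odd (n i.+1 %/ n i)] ->
           zmod_iso (H (2 * k - 1)%N) 'Z_2) /\
        (~ infinite_set [set i : nat | ~~ odd (n i.+1 %/ n i)] ->
           zmod_iso (H (2 * k - 1)%N) ('Z_2 * 'Z_2)%type)].
Proof.
move=> H; split=> [|k k1|k k1]; first exact: homology0_mean.
  have -> : (2 * k = (2 * k - 1).+1)%N by lia.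
  by move=> x; apply: homology_even; [exact: odometer_odd_split|lia].
have -> : (2 * k - 1 = (2 * k.-1).+1)%N by lia.
have ek : ~~ odd (2 * k.-1)%N by lia.
split=> [inf|/contrapT/finite_seqP[s sE]].
  apply: homology_odd_one_center ek => i; apply: contrapT => nj; apply: inf.
  apply: (sub_finite_set _ (finite_II i)) => j /= oj.
  by rewrite ltnNge; apply/negP => ij; apply: nj; exists j.
(* Beyond [i0] the parity of the periods is constant. *)
pose i0 := (\max_(a <- s) a).+1.
have oddq j : (i0 <= j)%N -> odd (n j.+1 %/ n j).
  move=> ij; apply/negPn/negP => ej.
  have : [set i | ~~ odd (n i.+1 %/ n i)] j by [].
  rewrite sE => /= js; have := @leq_bigmax_seq _ s predT id j js isT.
  by rewrite leqNgt ij.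
have [o0|e0] := boolP (odd (n i0)); last exact: homology_even_period e0 oddq _
  ek.
apply: homology_odd_period ek => j.
have [/(n_dvd_le n_dvd)/dvdnP[q nE]|ij] := leqP j i0.
  by move: o0; rewrite nE oddM => /andP[].
move/ltnW/subnK: ij => <-; elim: (j - i0)%N => // l IH; rewrite addSn.
have := oddq _ (leq_addl l i0); have /dvdnP[q nE] := n_dvd (l + i0)%N.
by rewrite nE mulnK ?n_gt0 // oddM IH => ->.
Qed.
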